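(* Let $\varphi$ be a topologically free and minimal action of a countable and non-amenable group $\Gamma$ on the Cantor set $X$. Then the topological full group $[[G_\varphi]]$ of the transformation groupoid $G_\varphi$ is $\mathrm{C}^*$-simple.
   Context: An action of a group $\Gamma$ (by homeomorphisms) on a topological space $X$ is topologically free if $\operatorname{Int}\{x\in X\mid gx=x\}=\emptyset$ for each $g\in\Gamma\setminus\{e\}$, and minimal if every orbit is dense. The transformation groupoid of an action $\varphi$ of a (discrete) group $\Gamma$ on a compact Hausdorff space $X$ is $G_\varphi:=\Gamma\times X$ with the product topology; the product of $(h,y),(g,x)$ is defined if and only if $y=gx$, in which case $(h,gx)(g,x):=(hg,x)$; inversion is $(g,x)^{-1}:=(g^{-1},gx)$. Its unit space $\{e\}\times X$ is identified with $X$, with source $s(g,x)=x$ and range $r(g,x)=gx$. A bisection is a subset $U\subset G_\varphi$ such that $r|_U$ and $s|_U$ are injective. The topological full group $[[G_\varphi]]$ is the group of compact open bisections $U\subset G_\varphi$ with $r(U)=s(U)=X$, with product $UV=\{uv\mid u\in U,v\in V, s(u)=r(v)\}$ and inverse $U^{-1}=\{u^{-1}\mid u\in U\}$. A (discrete) group is $\mathrm{C}^*$-simple if its reduced group $\mathrm{C}^*$-algebra is simple. *)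

(* Defs.v *)
From HB Require Import structures.
From mathcomp Require Import all_boot all_order all_algebra.
From mathcomp Require Import all_classical all_reals all_analysis.
From mathcomp Require Import complex ring lra.

Set Implicit Arguments.
Unset Strict Implicit.
Unset Printing Implicit Defensive.

Import Order.TTheory GRing.Theory Num.Theory.
Import numFieldNormedType.Exports.

Local Open Scope classical_set_scope.
Local Open Scope ring_scope.
Local Open Scope complex_scope.

HB.mixin Record isCompactHausdorff X & Topological X := {
  compact_setT : compact [set: X];
  hausdorff_setT : hausdorff_space X }.

#[short(type="compactHausdorffType")]
HB.structure Definition CompactHausdorff :=
  {X of isCompactHausdorff X & Topological X}.

HB.instance Definition _ :=
  isCompactHausdorff.Build cantor_space
    cantor_space_compact cantor_space_hausdorff.

(* Each [act g] is a homeomorphism, with inverse [act g^-1]. *)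
Record top_action (G : groupType) (X : topologicalType) := TopAction {
  act :> G -> X -> X;
  act_continuous : forall g, continuous (act g);
  act1 : forall x, act 1%g x = x;
  actM : forall g h x, act (g * h)%g x = act g (act h x) }.

Definition topologically_free (G : groupType) (X : topologicalType)
    (phi : top_action G X) :=
  forall g : G, g <> 1%g -> interior [set x | phi g x = x] = set0.

Definition minimal (G : groupType) (X : topologicalType)
    (phi : top_action G X) :=
  forall x : X, dense [set phi g x | g in [set: G]].

(* Left-invariant finitely additive probability measures on all subsets. *)
Definition invariant_mean (R : realType) (G : groupType) (m : set G -> R) :=
  [/\ forall A, 0 <= m A,
      m [set: G] = 1,
      forall A B, A `&` B = set0 -> m (A `|` B) = m A + m B &
      forall (g : G) A, m [set (g * a)%g | a in A] = m A].

Definition amenable (R : realType) (G : groupType) :=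
  exists m : set G -> R, invariant_mean m.

Definition transformation_groupoid (G : groupType) (X : topologicalType)
  (phi : top_action G X) : Type := (discrete_topology G * X)%type.

HB.instance Definition _ (G : groupType) (X : topologicalType)
  (phi : top_action G X) := Topological.on (transformation_groupoid phi).

Section Groupoid.
Variables (G : groupType) (X : topologicalType) (phi : top_action G X).
Local Notation Gphi := (transformation_groupoid phi).
Implicit Types (u v : Gphi) (U V : set Gphi).

Definition src u : X := u.2.
Definition rng u : X := phi u.1 u.2.
(* The product is total here; it is meaningful only when [src u = rng v]. *)
Definition gpd_mul u v : Gphi := ((u.1 : G) * v.1, v.2)%g.
Definition gpd_inv u : Gphi := ((u.1 : G)^-1, phi u.1 u.2)%g.

Definition bisection U := set_inj U rng /\ set_inj U src.

Definition full_bisection U :=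
  [/\ compact U, open U, bisection U, rng @` U = setT & src @` U = setT].

(* The unit space {e} x X. *)
Definition bis_one : set Gphi := [set u | u.1 = 1%g].
Definition bis_mul U V : set Gphi :=
  [set w | exists u v, [/\ U u, V v, src u = rng v & w = gpd_mul u v]].
Definition bis_inv U : set Gphi := [set gpd_inv u | u in U].

Lemma open_slices U : open U <-> forall g : G, open [set x | U (g, x)].
Proof.
split=> [oU g|oU].
  rewrite openE => x /= Ux.
  have : nbhs ((g, x) : Gphi) U by apply: open_nbhs_nbhs.
  case=> -[A B] /= [Ag Bx] AB; apply: filterS Bx => y By.
  by apply: (AB (g, y)); split => //=; exact: (nbhs_singleton Ag).
rewrite openE => -[g x] Ux.
exists ([set g], [set y | U (g, y)]) => /=.
  split; first by apply: (@discrete_set1 (discrete_topology G)).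
  by apply: open_nbhs_nbhs; split => //; apply: oU.
by move=> [h y] /= [-> ].
Qed.

Lemma mem_bis_mul U V (k : G) x : bis_mul U V (k, x) <->
  exists g : G, V (g, x) /\ U ((k * g^-1)%g, phi g x).
Proof.
split=> [[[h y] [[g z] [/= Uu Vv]]]|[g [Vg Uk]]].
  by rewrite /src /rng /= => e [-> ->]; exists g; rewrite mulgK -e.
by exists ((k * g^-1)%g, phi g x), (g, x); split => //; rewrite /gpd_mul /= mulgVK.
Qed.

Lemma mem_bis_inv U (k : G) y : bis_inv U (k, y) <-> U ((k^-1)%g, phi k y).
Proof.
split=> [[[g x] /= Ug [<- <-]]|Uk]; first by rewrite invgK -actM mulVg act1.
by exists ((k^-1)%g, phi k y); rewrite // /gpd_inv /= invgK -actM mulVg act1.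
Qed.

Lemma src_val U g h x : bisection U -> U (g, x) -> U (h, x) -> g = h.
Proof.
move=> [_ si] Ug Uh.
by have := si _ _ (mem_set Ug) (mem_set Uh) erefl => -[].
Qed.

Lemma rng_val U g h x y : bisection U -> U (g, x) -> U (h, y) ->
  phi g x = phi h y -> g = h /\ x = y.
Proof.
move=> [ri _] Ug Uh e.
by have := ri _ _ (mem_set Ug) (mem_set Uh) e => -[].
Qed.

Lemma open_bisection_compact U : compact [set: X] ->
  open U -> bisection U -> src @` U = setT -> compact U.
Proof.
move=> cX oU bU sU.
have ex x : {g : G | U (g, x)}.
  apply: cid; have : (src @` U) x by rewrite sU.
  by move=> [[g y] Ugy /= <-]; exists g.
pose f x : Gphi := (sval (ex x), x).
have -> : U = f @` setT.
  apply/seteqP; split=> [[g x] Ugx|u [x _ <-]]; last exact: (svalP (ex x)).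
  by exists x => //; rewrite /f (src_val bU (svalP (ex x)) Ugx).
apply: continuous_compact => //; apply: continuous_subspaceT => x W.
have := svalP (ex x); set g := sval (ex x) => Ugx.
case=> -[A B] /= [Ag Bx] AB.
have oUg := (open_slices U).1 oU g.
have nU : nbhs x [set y | U (g, y)] by apply: open_nbhs_nbhs; split.
apply: (@filterS2 X (nbhs x) _ _ _ _ _ nU Bx) => y /= Ugy By.
rewrite /f (src_val bU (svalP (ex y)) Ugy).
by apply: AB; split => //=; exact: (nbhs_singleton Ag).
Qed.

Lemma act_inj g : injective (phi g).
Proof. by move=> x y e; rewrite -(act1 phi x) -(mulVg g) actM e -actM mulVg act1. Qed.

End Groupoid.

Arguments bis_one {G X} phi.

Section FullGroup.
Variables (G : groupType) (X : compactHausdorffType) (phi : top_action G X).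
Local Notation Gphi := (transformation_groupoid phi).

Record full_group := FullGroup {
  bis_of :> set Gphi;
  full_bis_of : full_bisection bis_of }.

HB.instance Definition _ := gen_eqMixin full_group.
HB.instance Definition _ := gen_choiceMixin full_group.

Lemma full_group_eq (U V : full_group) : bis_of U = bis_of V -> U = V.
Proof.
by case: U V => [U pU] [V pV] /= e; subst V; congr FullGroup; exact: Prop_irrelevance.
Qed.

Lemma full_bis_one : full_bisection (bis_one phi).
Proof.
have o1 : open (bis_one phi).
  apply/open_slices => g; have [->|g1] := pselect (g = 1%g).
    have -> : [set x | bis_one phi (1%g, x)] = setT by apply/seteqP; split.
    exact: openT.
  have -> : [set x | bis_one phi (g, x)] = set0 by apply/seteqP; split.
  exact: open0.
have b1 : bisection (bis_one phi).
  split=> -[g x] [h y]; rewrite !inE /bis_one /rng /src /= => -> ->.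
    by rewrite !act1 => ->.
  by move=> ->.
have s1 : @src _ _ phi @` bis_one phi = setT.
  by apply/seteqP; split => // x _; exists (1%g, x).
split => //; first by apply: open_bisection_compact => //; exact: compact_setT.
by apply/seteqP; split => // x _; exists (1%g, x) => //; rewrite /rng /= act1.
Qed.

Lemma full_bis_mul (U V : set Gphi) :
  full_bisection U -> full_bisection V -> full_bisection (bis_mul U V).
Proof.
move=> [_ oU bU rU sU] [_ oV bV rV sV].
have oUV : open (bis_mul U V).
  apply/open_slices => k.
  have -> : [set x | bis_mul U V (k, x)] = \bigcup_(g : G)
      ([set x | V (g, x)] `&` phi g @^-1` [set x | U ((k * g^-1)%g, x)]).
    apply/seteqP; split=> x /=.
      by move=> /mem_bis_mul[g [? ?]]; exists g.
    by move=> [g _ [? ?]]; apply/mem_bis_mul; exists g.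
  apply: bigcup_open => g _; apply: openI; first exact: (open_slices V).1 oV g.
  apply: open_comp; last exact: (open_slices U).1 oU (k * g^-1)%g.
  by move=> x _; exact: act_continuous.
have bUV : bisection (bis_mul U V).
  split=> -[k x] [l y]; rewrite !inE /rng /src /=.
    move=> /mem_bis_mul[g [Vg Ug]] /mem_bis_mul[h [Vh Uh]] e.
    have [] := rng_val bU Ug Uh; first by rewrite -!actM !mulgVK.
    move=> e1 e2; have [e3 e4] := rng_val bV Vg Vh e2.
    by move: e1; rewrite e3 e4 => /mulIg ->.
  move=> + + e; rewrite -{y}e.
  move=> /mem_bis_mul[g [Vg Ug]] /mem_bis_mul[h [Vh Uh]].
  have e := src_val bV Vg Vh; rewrite -e in Uh.
  by have /mulIg -> := src_val bU Ug Uh.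
have sUV : @src _ _ phi @` bis_mul U V = setT.
  apply/seteqP; split => // x _.
  have : (@src _ _ phi @` V) x by rewrite sV.
  move=> [[g y] Vg]; rewrite /src /= => e; rewrite -{x}e.
  have : (@src _ _ phi @` U) (phi g y) by rewrite sU.
  move=> [[h z] Uh]; rewrite /src /= => e; rewrite e in Uh.
  by exists ((h * g)%g, y) => //; apply/mem_bis_mul; exists g; rewrite mulgK.
split => //; first by apply: open_bisection_compact => //; exact: compact_setT.
apply/seteqP; split => // x _.
have : (@rng _ _ phi @` U) x by rewrite rU.
move=> [[g y] Ug]; rewrite /rng /= => e; rewrite -{x}e.
have : (@rng _ _ phi @` V) y by rewrite rV.
move=> [[h z] Vh]; rewrite /rng /= => e; rewrite -{}e in Ug *.
exists ((g * h)%g, z); last by rewrite /= actM.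
by apply/mem_bis_mul; exists h; rewrite mulgK.
Qed.

Lemma full_bis_inv (U : set Gphi) :
  full_bisection U -> full_bisection (bis_inv U).
Proof.
move=> [_ oU bU rU sU].
have oV : open (bis_inv U).
  apply/open_slices => k.
  have -> : [set x | bis_inv U (k, x)] =
      phi k @^-1` [set x | U ((k^-1)%g, x)].
    by apply/seteqP; split=> x /mem_bis_inv.
  apply: open_comp; last exact: (open_slices U).1 oU (k^-1)%g.
  by move=> x _; exact: act_continuous.
have bV : bisection (bis_inv U).
  split=> -[k x] [l y]; rewrite !inE /rng /src /= => /mem_bis_inv Uk /mem_bis_inv Ul.
    move=> e; rewrite -e in Ul; have /invg_inj ekl := src_val bU Uk Ul.
    by rewrite -ekl in e *; rewrite (act_inj e).
  move=> e; rewrite -e in Ul *.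
  have [] := rng_val bU Uk Ul; first by rewrite -!actM !mulVg.
  by move=> /invg_inj ->.
have sV : @src _ _ phi @` bis_inv U = setT.
  apply/seteqP; split => // x _.
  have : (@rng _ _ phi @` U) x by rewrite rU.
  by move=> [u Uu e]; exists (gpd_inv u) => //; exists u.
split => //; first by apply: open_bisection_compact => //; exact: compact_setT.
apply/seteqP; split => // x _.
have : (@src _ _ phi @` U) x by rewrite sU.
move=> [u Uu <-]; exists (gpd_inv u); first by exists u.
by rewrite /rng /src /gpd_inv /= -actM mulVg act1.
Qed.

Definition full_one := FullGroup full_bis_one.
Definition full_mul (U V : full_group) :=
  FullGroup (full_bis_mul (full_bis_of U) (full_bis_of V)).
Definition full_inv (U : full_group) :=
  FullGroup (full_bis_inv (full_bis_of U)).

Lemma full_mulA : associative full_mul.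
Proof.
move=> U V W; apply: full_group_eq => /=; apply/seteqP; split=> -[k x].
  move=> /mem_bis_mul[g [/mem_bis_mul[h [Wh Vh]] Ug]].
  apply/mem_bis_mul; exists h; split => //; apply/mem_bis_mul.
  exists (g * h^-1)%g; split => //.
  by rewrite -actM mulgVK invgM invgK mulgA mulgVK.
move=> /mem_bis_mul[h [Wh /mem_bis_mul[g [Vg Ug]]]].
apply/mem_bis_mul; exists (g * h)%g; split.
  by apply/mem_bis_mul; exists h; rewrite mulgK.
by rewrite actM invgM mulgA.
Qed.

Lemma full_mul1g : left_id full_one full_mul.
Proof.
move=> U; apply: full_group_eq => /=; apply/seteqP; split=> -[k x].
  by move=> /mem_bis_mul[g [Ug /= /divg1_eq ->]].
by move=> Uk; apply/mem_bis_mul; exists k; split => //; rewrite /bis_one /= mulgV.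
Qed.

Lemma full_mulg1 : right_id full_one full_mul.
Proof.
move=> U; apply: full_group_eq => /=; apply/seteqP; split=> -[k x].
  by move=> /mem_bis_mul[g [Ug Uk]]; rewrite /bis_one /= in Ug; move: Uk; rewrite Ug invg1 mulg1 act1.
by move=> Uk; apply/mem_bis_mul; exists 1%g; split => //; rewrite invg1 mulg1 act1.
Qed.

Lemma full_mulVg : left_inverse full_one full_inv full_mul.
Proof.
move=> U; have [_ _ bU _ sU] := full_bis_of U.
apply: full_group_eq => /=; apply/seteqP; split=> -[k x].
  move=> /mem_bis_mul[g [Ug /mem_bis_inv]]; rewrite -actM mulgVK => Ugk.
  have [] := rng_val bU Ugk Ug.
    by rewrite -actM invgM invgK mulgVK.
  rewrite invgM invgK -{2}(mulg1 g) => /mulgI k1 _.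
  by rewrite /bis_one /= -(invgK k) k1 invg1.
move=> /= k1; have : (@src _ _ phi @` U) x by rewrite sU.
rewrite /bis_one /= in k1; rewrite {}k1.
move=> [[g y] Ug /= <-]; apply/mem_bis_mul; exists g; split => //.
by apply/mem_bis_inv; rewrite mul1g invgK -actM mulVg act1.
Qed.

Lemma full_mulgV : right_inverse full_one full_inv full_mul.
Proof.
move=> U; have [_ _ bU rU _] := full_bis_of U.
apply: full_group_eq => /=; apply/seteqP; split=> -[k x].
  move=> /mem_bis_mul[g [/mem_bis_inv Ug Ukg]].
  by have := src_val bU Ug Ukg; rewrite -{1}(mul1g (g^-1)%g) => /mulIg <-.
move=> /= k1; have : (@rng _ _ phi @` U) x by rewrite rU.
rewrite /bis_one /= in k1; rewrite {}k1.
move=> [[g y] Ug]; rewrite /rng /= => <-.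
apply/mem_bis_mul; exists (g^-1)%g.
rewrite mul1g invgK -actM mulVg act1; split => //.
by apply/mem_bis_inv; rewrite invgK -actM mulVg act1.
Qed.

HB.instance Definition _ := isGroup.Build full_group
  full_mulA full_mul1g full_mulg1 full_mulVg full_mulgV.

End FullGroup.

Section SquareSummable.
Variables (R : realType) (G : groupType).
Local Notation C := R[i].
Local Notation normc := ComplexField.Normc.normc.
Implicit Types f : G -> C^o.

Definition sqnorm f : \bar R := \esum_(g in [set: G]) (normc (f g) ^+ 2)%:E.

Lemma sqnorm_ge0 f : (0 <= sqnorm f)%E.
Proof. by apply: esum_ge0 => g _; rewrite lee_fin sqr_ge0. Qed.

Lemma sqnorm0 : sqnorm 0 = 0%E.
Proof. by apply: esum1 => g _; rewrite ComplexField.Normc.normc0 expr0n. Qed.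

Lemma sqnorm_eq0 f : sqnorm f = 0%E -> f = 0.
Proof.
move=> f0; apply/funext => g; apply: ComplexField.Normc.eq0_normc.
apply/eqP; rewrite -sqrf_eq0 eq_le sqr_ge0 andbT -lee_fin -[leRHS]f0.
apply: esum_ge; exists [set g]; first by split.
by rewrite fsbig_set1.
Qed.

Lemma le_sqnormZ (c : C) f : (sqnorm (c *: f) <= (normc c ^+ 2)%:E * sqnorm f)%E.
Proof.
apply: ge_ereal_sup => _ [A [finA _] <-].
have -> : (\sum_(g \in A) (normc ((c *: f) g) ^+ 2)%:E =
    (normc c ^+ 2)%:E * \sum_(g \in A) (normc (f g) ^+ 2)%:E)%E.
  rewrite !fsbig_finite //= ge0_sume_distrr; last first.
    by move=> g _; rewrite lee_fin sqr_ge0.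
  by apply: eq_bigr => g _; rewrite -EFinM -exprMn -ComplexField.Normc.normcM.
apply: lee_pmul => //; first by rewrite lee_fin sqr_ge0.
  by apply: fsume_ge0 => g _; rewrite lee_fin sqr_ge0.
by apply: esum_ge; exists A.
Qed.

Lemma sqnormZ (c : C) f : sqnorm (c *: f) = ((normc c ^+ 2)%:E * sqnorm f)%E.
Proof.
have [->|c0] := eqVneq c 0.
  by rewrite scale0r sqnorm0 ComplexField.Normc.normc0 expr0n mul0e.
apply/eqP; rewrite eq_le le_sqnormZ /=.
have n0 : 0 < normc c ^+ 2.
  rewrite lt_def sqr_ge0 andbT sqrf_eq0.
  by apply: contra c0 => /eqP/ComplexField.Normc.eq0_normc ->.
rewrite -lee_pdivlMl //.
have := le_sqnormZ c^-1 (c *: f).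
by rewrite scalerA mulVf // scale1r ComplexField.Normc.normcV exprVn.
Qed.

Lemma le_sqnormD (t : R) f g : 0 < t ->
  (sqnorm (f + g)%R <= (1 + t)%:E * sqnorm f + (1 + t^-1)%:E * sqnorm g)%E.
Proof.
move=> t0; have s0 : 0 < t^-1 by rewrite invr_gt0.
have nt (r : R) h : 0 < r ->
    (r%:E * sqnorm h = \esum_(x in [set: G]) (r * normc (h x) ^+ 2)%:E)%E.
  move=> r0; have -> : r = normc ((Num.sqrt r)%:C) ^+ 2.
    by rewrite /= expr0n addr0 sqrtr_sqr ger0_norm ?sqrtr_ge0 // sqr_sqrtr // ltW.
  rewrite -sqnormZ; apply: eq_esum => x _.
  by rewrite -exprMn -ComplexField.Normc.normcM.
rewrite !nt ?addr_gt0 // -esumD; last 2 first.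
- by move=> x _; rewrite lee_fin mulr_ge0 ?sqr_ge0 // addr_ge0 // ltW.
- by move=> x _; rewrite lee_fin mulr_ge0 ?sqr_ge0 // addr_ge0 // ltW.
apply: le_esum => x _; rewrite -EFinD lee_fin.
set u := normc (f x); set v := normc (g x).
have uv : normc ((f + g) x) <= u + v by exact: le_normcD.
have w0 : 0 <= normc ((f + g) x) by rewrite /normc; case: ((f + g) x) => ??; exact: sqrtr_ge0.
apply: (@le_trans _ _ ((u + v) ^+ 2)); first by rewrite ler_sqr ?nnegrE //; exact: le_trans uv.
rewrite -subr_ge0.
have -> : (1 + t) * u ^+ 2 + (1 + t^-1) * v ^+ 2 - (u + v) ^+ 2 =
    t^-1 * (t * u - v) ^+ 2 by field; rewrite gt_eqF.
by rewrite mulr_ge0 ?sqr_ge0 // ltW.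
Qed.

Definition l2_pred : {pred G -> C^o} := [pred f | (sqnorm f < +oo)%E].

Lemma l2_submod_closed : submod_closed l2_pred.
Proof.
split; first by rewrite inE sqnorm0 ltry.
move=> c f g; rewrite !inE => ff fg.
apply: le_lt_trans (le_sqnormD _ _ ltr01) _.
rewrite sqnormZ lte_add_pinfty // lte_mul_pinfty ?lee_fin ?addr_ge0 ?invr_ge0 //.
by rewrite lte_mul_pinfty ?lee_fin ?sqr_ge0.
Qed.

HB.instance Definition _ :=
  GRing.isSubmodClosed.Build C (G -> C^o) l2_pred l2_submod_closed.

Record l2 := L2 { l2_fun :> G -> C^o; l2_funP : l2_fun \in l2_pred }.

HB.instance Definition _ := [isSub for l2_fun].
HB.instance Definition _ := [Choice of l2 by <:].
HB.instance Definition _ := [SubChoice_isSubLmodule of l2 by <:].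

Definition l2norm (f : l2) : R := Num.sqrt (fine (sqnorm f)).

Lemma sqnormE (f : l2) : sqnorm f = (l2norm f ^+ 2)%:E.
Proof.
have := l2_funP f; rewrite inE => ff; have f0 := sqnorm_ge0 f.
by rewrite /l2norm sqr_sqrtr ?fine_ge0 // fineK // ge0_fin_numE.
Qed.

Lemma l2norm_ge0 (f : l2) : 0 <= l2norm f.
Proof. exact: sqrtr_ge0. Qed.

Lemma l2norm_eq0 (f : l2) : l2norm f = 0 -> f = 0.
Proof.
move=> f0; apply: val_inj => /=; apply: sqnorm_eq0.
by rewrite sqnormE f0 expr0n.
Qed.

Lemma l2normZ (c : C) (f : l2) : l2norm (c *: f) = normc c * l2norm f.
Proof.
have c0 : 0 <= normc c by case: c => ??; exact: sqrtr_ge0.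
apply/eqP; rewrite -(@eqrXn2 _ 2) ?mulr_ge0 ?l2norm_ge0 //.
have := sqnormZ c f; rewrite (sqnormE f) -EFinM.
have -> : sqnorm (c *: (f : G -> C^o)) = sqnorm (c *: f) by [].
by rewrite sqnormE => -[->]; rewrite exprMn.
Qed.

Lemma ler_l2normD (f g : l2) : l2norm (f + g) <= l2norm f + l2norm g.
Proof.
have [f0|f0] := eqVneq (l2norm f) 0.
  by rewrite (l2norm_eq0 f0) add0r lerDr l2norm_ge0.
have [g0|g0] := eqVneq (l2norm g) 0.
  by rewrite (l2norm_eq0 g0) addr0 lerDl l2norm_ge0.
have pf : 0 < l2norm f by rewrite lt_def f0 l2norm_ge0.
have pg : 0 < l2norm g by rewrite lt_def g0 l2norm_ge0.
rewrite -ler_sqr ?nnegrE ?addr_ge0 ?l2norm_ge0 //.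
have := le_sqnormD f g (divr_gt0 pg pf).
have -> : sqnorm ((f : G -> C^o) + (g : G -> C^o)) = sqnorm (f + g) by [].
rewrite !sqnormE -!EFinM -EFinD lee_fin => /le_trans; apply.
rewrite le_eqVlt; apply/orP; left; apply/eqP; field.
by rewrite f0 g0.
Qed.

Let norm (f : l2) : C := (l2norm f)%:C.

Let normD (f g : l2) : norm (f + g) <= norm f + norm g.
Proof. by rewrite /norm -rmorphD lecR ler_l2normD. Qed.

Let normZ (c : C) (f : l2) : norm (c *: f) = `|c| * norm f.
Proof. by rewrite /norm l2normZ rmorphM; case: c. Qed.

Let norm_eq0 (f : l2) : norm f = 0 -> f = 0.
Proof. by move=> /complexI/l2norm_eq0. Qed.

HB.instance Definition _ := Lmodule_isNormed.Build C l2 normD normZ norm_eq0.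

Lemma translate_subproof (g : G) (f : l2) :
  (fun x : G => f (g^-1 * x)%g) \in l2_pred.
Proof.
have := l2_funP f; rewrite !inE /sqnorm.
rewrite (@reindex_esum _ _ _ [set: G] [set: G] (fun x => (g^-1 * x)%g)) //.
split=> //; first by move=> x y _ _ /mulgI.
by move=> x _; exists (g * x)%g; rewrite // mulKg.
Qed.

Definition left_regular (g : G) (f : l2) : l2 := L2 (translate_subproof g f).

End SquareSummable.

Section OperatorAlgebras.
Variables (R : realType) (H : normedModType R[i]).
Implicit Types (S T : H -> H) (A I : set (H -> H)).

Definition bounded_operator T := linear T /\ continuous T.

(* The operator norm of T is at most e. *)
Definition opnorm_le T (e : R) := forall x : H, `|T x| <= e%:C * `|x|.

(* Closure in operator norm, inside the algebra of bounded operators on H. *)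
Definition norm_closure A : set (H -> H) :=
  [set T | bounded_operator T /\
    forall e : R, 0 < e -> exists2 S, A S & opnorm_le (T - S) e].

Definition closed_ideal A I :=
  [/\ I `<=` A,
      I 0,
      forall (c : R[i]) S T, I S -> I T -> I (c *: S + T),
      forall S T, A S -> I T -> I (S \o T) /\ I (T \o S) &
      norm_closure I `<=` I].

Definition simple_algebra A :=
  (exists2 T, A T & T <> 0) /\
  forall I, closed_ideal A I -> I = [set 0] \/ I = A.

End OperatorAlgebras.

Definition regular_group_algebra (R : realType) (G : groupType) :
    set (l2 R G -> l2 R G) :=
  [set T | exists s : seq (R[i] * G),
    T = \sum_(p <- s) p.1 *: left_regular p.2].

Definition reduced_group_Cstar_algebra (R : realType) (G : groupType) :=
  norm_closure (@regular_group_algebra R G).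

Definition Cstar_simple (R : realType) (G : groupType) :=
  simple_algebra (@reduced_group_Cstar_algebra R G).

(* Main.v *)
From HB Require Import structures.
Require Import Defs.
From mathcomp Require Import all_boot all_order all_algebra.
From mathcomp Require Import all_classical all_reals all_analysis.
From mathcomp Require Import complex ring lra.

(** Every nontrivial element [t] of the full group moves some point, by
    topological freeness, hence displaces a small clopen set [U]. Let [K] be the
    rigid stabilizer of [U], the group of elements that are trivial off [U].
    The theorem follows from three facts about [K].

    First, [K] is far from amenable: it preserves no finitely additive mean on
    the set [arrows_into U] of arrows of the groupoid that end in [U]. Indeed
    swaps of small disjoint clopen subsets of [U] lie in [K], and they generate
    locally all partial translations inside [U], so a [K]-invariant mean is
    invariant under partial translations ([mean_translate]). By minimality
    finitely many translates of [U] cover the space, and gluing copies of the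
    mean along such a cover gives an invariant mean on [Gamma]
    ([amenable_of_mean]), which is excluded.

    Second, by Kesten's argument, the absence of an invariant mean makes some
    averages over finite subsets of [K] act on the square summable functions on
    [arrows_into U] with norm as small as desired ([average_small]).

    Third, this smallness passes to the averages of the conjugates
    [s * t * s^-1], [s] in [K], in the regular representation of the full group.
    Write [s * t * s^-1] as [s * (t * s^-1 * t^-1) * t]: as [t] displaces [U],
    the middle factor is trivial on [U]. There is a map from the full group to
    [arrows_into U] that is equivariant for [K] and invariant under its
    conjugate by [t] ([landing_arrow]), and taking square norms along its fibres
    bounds the average in the regular representation by the average on
    [arrows_into U] ([twirl_le_average]).

    Finitely many elements are treated at once with disjoint displaced sets,
    whose rigid stabilizers commute ([twirl_all]). This is the averaging
    property of Powers, and it forces simplicity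
    ([simple_of_powers_averaging]): a nonzero ideal contains an element of trace
    one, and averaging its conjugates brings it arbitrarily close to the
    identity. *)

Set Implicit Arguments.
Unset Strict Implicit.
Unset Printing Implicit Defensive.

Import Order.TTheory GRing.Theory Num.Theory.
Import numFieldNormedType.Exports.

Local Open Scope classical_set_scope.
Local Open Scope ring_scope.
Local Open Scope complex_scope.

(** * The full group as a group of homeomorphisms *)

Section Cocycle.
Variables (Gamma : groupType) (X : compactHausdorffType).
Variable phi : top_action Gamma X.
Local Notation Gphi := (transformation_groupoid phi).
Local Notation FG := (full_group phi).
Implicit Types (h k t : FG) (x y : X) (U V W : set X) (u v : Gphi).

Lemma full_group_total h x : exists g : Gamma, bis_of h (g, x).
Proof.
have [_ _ _ _ sU] := full_bis_of h.
have : (@src _ _ phi @` bis_of h) x by rewrite sU.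
by case=> -[g y] hg <-; exists g.
Qed.

Definition cocycle h x : Gamma := projT1 (cid (full_group_total h x)).

Lemma cocycleP h x : bis_of h (cocycle h x, x).
Proof. exact: projT2 (cid (full_group_total h x)). Qed.

Lemma cocycle_eq h x (g : Gamma) : bis_of h (g, x) -> cocycle h x = g.
Proof.
have [_ _ bU _ _] := full_bis_of h.
exact: src_val bU (cocycleP h x).
Qed.

Definition homeo h x : X := phi (cocycle h x) x.

Lemma cocycleM h k x :
  cocycle (h * k)%g x = (cocycle h (homeo k x) * cocycle k x)%g.
Proof.
apply: cocycle_eq; apply/mem_bis_mul; exists (cocycle k x).
by split; [exact: cocycleP|rewrite mulgK; exact: cocycleP].
Qed.

Lemma cocycle1 x : cocycle 1%g x = 1%g. Proof. exact: cocycle_eq. Qed.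

Lemma homeoM h k x : homeo (h * k)%g x = homeo h (homeo k x).
Proof. by rewrite /homeo cocycleM actM. Qed.

Lemma homeo1 x : homeo 1%g x = x. Proof. by rewrite /homeo cocycle1 act1. Qed.

Lemma homeoK h x : homeo h^-1%g (homeo h x) = x.
Proof. by rewrite -homeoM mulVg homeo1. Qed.

Lemma homeoVK h x : homeo h (homeo h^-1%g x) = x.
Proof. by rewrite -homeoM mulgV homeo1. Qed.

Lemma cocycle_ext h k : cocycle h =1 cocycle k -> h = k.
Proof.
move=> e; apply: full_group_eq; apply/seteqP; split=> -[g x].
  by move=> /cocycle_eq <-; rewrite e; exact: cocycleP.
by move=> /cocycle_eq <-; rewrite -e; exact: cocycleP.
Qed.

Lemma near_cocycle h x : \forall y \near x, cocycle h y = cocycle h x.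
Proof.
have [_ /open_slices oU _ _ _] := full_bis_of h.
have : nbhs x [set y | bis_of h (cocycle h x, y)].
  by apply: open_nbhs_nbhs; split; [exact: oU|exact: cocycleP].
by apply: filterS => y /cocycle_eq.
Qed.

Lemma continuous_homeo h : continuous (homeo h).
Proof.
move=> x; have e := near_cocycle h x.
have c : phi (cocycle h x) y @[y --> x] --> homeo h x by exact: act_continuous.
apply: cvg_trans c; apply: near_eq_cvg.
by near=> y; rewrite /homeo (near e y).
Unshelve. all: by end_near. Qed.

(** The graph of a locally constant function to [Gamma] is open, and it is a
    bisection as soon as the function induces a permutation of the space. *)
Lemma full_group_of_cocycle (c : X -> Gamma) (d : X -> X) :
  (forall x, \forall y \near x, c y = c x) ->
  cancel d (fun x => phi (c x) x) -> cancel (fun x => phi (c x) x) d ->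
  exists h, forall x, cocycle h x = c x.
Proof.
move=> lc dK Kd.
pose B : set Gphi := [set u | u.1 = c u.2].
have oB : open B.
  apply/open_slices => g; rewrite openE => x /= Bx.
  by have := lc x; apply: filterS => y e; rewrite /B /= e.
have sB : @src _ _ phi @` B = setT.
  by apply/seteqP; split => // x _; exists (c x, x).
have bB : bisection B.
  split=> -[g x] [g' y]; rewrite !inE /B /rng /src /= => -> ->.
    by move=> e; have -> : x = y by rewrite -(Kd x) e Kd.
  by move=> ->.
have fB : full_bisection B.
  split => //.
    by apply: open_bisection_compact => //; exact: compact_setT.
  apply/seteqP; split => // x _; exists (c (d x), d x) => //.
  exact: dK.
by exists (FullGroup fB) => x; apply: cocycle_eq.
Qed.

(** Left multiplication of arrows by a full bisection. The full group acts on
    arrows rather than on points because an arrow remembers an element of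
    [Gamma], which is what carries a mean over to [Gamma]. *)
Definition gact h u : Gphi := ((cocycle h (rng u) * u.1)%g, u.2).

Lemma rng_gact h u : rng (gact h u) = homeo h (rng u).
Proof. by rewrite /rng /= actM. Qed.

Lemma gact1 u : gact 1%g u = u.
Proof. by case: u => g x; rewrite /gact cocycle1 mul1g. Qed.

Lemma gactM h k u : gact (h * k)%g u = gact h (gact k u).
Proof. by rewrite {2}/gact rng_gact /gact cocycleM -mulgA. Qed.

Definition rigid_stabilizer U : set FG :=
  [set k | forall x, ~ U x -> cocycle k x = 1%g].
Local Notation K := rigid_stabilizer.

Definition arrows_into U : set Gphi := [set u | U (rng u)].

Lemma rigid_homeo U k x : K U k -> ~ U x -> homeo k x = x.
Proof. by move=> Kk Ux; rewrite /homeo Kk // act1. Qed.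

Lemma rigid1 U : K U 1%g. Proof. by move=> x _; exact: cocycle1. Qed.

Lemma rigidM U h k : K U h -> K U k -> K U (h * k)%g.
Proof.
move=> Kh Kk x Ux; rewrite cocycleM (rigid_homeo Kk) // Kh // Kk //.
exact: mulg1.
Qed.

Lemma rigidV U k : K U k -> K U k^-1%g.
Proof.
move=> Kk x Ux; have := cocycleM k^-1%g k x.
by rewrite (rigid_homeo Kk) // mulVg cocycle1 Kk // mulg1.
Qed.

Lemma rigid_stable U k x : K U k -> U (homeo k x) <-> U x.
Proof.
move=> Kk; split=> [Ukx|Ux]; apply: contrapT => nU.
  by move: Ukx; rewrite (rigid_homeo Kk).
have e := rigid_homeo (rigidV Kk) nU.
by apply: nU; rewrite -e homeoK.
Qed.

Lemma sub_rigid U V : U `<=` V -> K U `<=` K V.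
Proof. by move=> UV k Kk x Vx; apply: Kk => /UV. Qed.

Lemma rigid_commute U V h k : U `&` V = set0 -> K U h -> K V k ->
  (h * k = k * h)%g.
Proof.
move=> UV Kh Kk; apply: cocycle_ext => x.
have disj z : U z -> ~ V z.
  by move=> Uz Vz; have : (U `&` V) z by []; rewrite UV.
rewrite !cocycleM.
have [Ux|Ux] := pselect (U x).
  have Vx := disj _ Ux.
  rewrite (rigid_homeo Kk Vx) (Kk _ Vx) mulg1.
  by rewrite Kk ?mul1g //; apply: disj; apply/(rigid_stable x Kh).
rewrite (rigid_homeo Kh Ux) (Kh _ Ux) mulg1.
have [Vx|Vx] := pselect (V x); last by rewrite (rigid_homeo Kk Vx) Kh // mul1g.
rewrite Kh ?mul1g // => /disj; apply; exact/(rigid_stable x Kk).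
Qed.

Lemma gact_arrows U k u : K U k -> arrows_into U u -> arrows_into U (gact k u).
Proof.
by rewrite /arrows_into /= => Kk Uu; rewrite rng_gact; exact/rigid_stable.
Qed.

(** A nontrivial value of the cocycle is taken on an open set, and topological
    freeness forbids that all its points be fixed. *)
Lemma moved_point t : topologically_free phi -> t <> 1%g ->
  exists x, homeo t x <> x.
Proof.
move=> free t1; apply: contrapT => /forallNP fixall; apply: t1.
apply: cocycle_ext => x; rewrite cocycle1; apply: contrapT => c1.
have : interior [set y | phi (cocycle t x) y = y] x.
  have := near_cocycle t x; apply: filterS => y e /=.
  by have /contrapT := fixall y; rewrite /homeo e.
by rewrite (free _ c1).
Qed.

End Cocycle.

Arguments rigid_stabilizer {Gamma X} phi U _.
Arguments arrows_into {Gamma X} phi U _.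
Arguments gact {Gamma X} phi h u.

(** * From a mean on the arrows into a clopen set to amenability *)

(** The acting elements and the space acted upon are subsets [K] and [D] of
    ambient types, as for a rigid stabilizer acting on the arrows into a set. *)
Definition mean_on (R : realType) (G T : Type) (a : G -> T -> T)
    (K : set G) (D : set T) (m : set T -> R) :=
  [/\ forall A, 0 <= m A,
      m D = 1,
      forall A B, A `&` B = set0 -> m (A `|` B) = m A + m B &
      forall k A, K k -> A `<=` D -> m (a k @` A) = m A].

Section ClopenSets.
Variable X : topologicalType.
Implicit Types (K U V W A B : set X).

(** Reasoning on finite covers, for a property of sets inherited by subsets and
    finite unions. If it failed for [K], the sets whose complement in [K] has it
    would form a proper filter, and the property would fail on every
    neighbourhood of a cluster point of this filter. *)
Lemma compact_ideal K (Q : set X -> Prop) : compact K -> Q set0 ->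
  (forall A B, Q A -> Q B -> Q (A `|` B)) ->
  (forall A B, A `<=` B -> Q B -> Q A) ->
  (forall x, K x -> exists2 V, nbhs x V & Q V) -> Q K.
Proof.
move=> cK Q0 QU QS loc; apply: contrapT => nQ.
pose F : set_system X := [set A | Q (K `\` A)].
have FF : ProperFilter F.
  apply: Build_ProperFilter_ex => [A FA|].
    apply: contrapT => /forallNP A0; apply: nQ; apply: QS FA => x Kx.
    by split => // /A0.
  split; first by rewrite /F /= setDT.
    by move=> A B FA FB; rewrite /F /= setDIr; apply: QU.
  by move=> A B AB; apply: QS => x [Kx nB]; split => // /AB.
have FK : F K by rewrite /F /= setDv.
have [x [Kx clx]] := cK F FF FK.
have [V Vx QV] := loc x Kx.
have FV : F (~` V) by apply: QS QV => y [_ /contrapT].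
by have [y []] := clx _ _ FV Vx.
Qed.

Lemma near_clopen V x : clopen V -> \forall y \near x, V y = V x.
Proof.
move=> [oV cV]; have [Vx|Vx] := pselect (V x).
  have : nbhs x V by apply: open_nbhs_nbhs.
  by apply: filterS => y Vy; apply/propext; split.
have : nbhs x (~` V).
  by apply: open_nbhs_nbhs; split => //; exact: closed_openC.
by apply: filterS => y Vy; apply/propext; split => // /Vy.
Qed.

Lemma clopen_nbhs_basis V x : hausdorff_space X -> zero_dimensional X ->
  compact [set: X] -> nbhs x V -> exists U, [/\ clopen U, U x & U `<=` V].
Proof.
move=> hX zX cX /(zero_dimensional_cvg hX zX cX).
by case=> U [Ux cU] UV; exists U.
Qed.

Lemma displaced_clopen (f : X -> X) V x : hausdorff_space X ->
  zero_dimensional X -> compact [set: X] -> {for x, continuous f} ->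
  nbhs x V -> f x <> x ->
  exists U, [/\ clopen U, U x, U `<=` V & forall y, U y -> ~ U (f y)].
Proof.
move=> hX zX cX cf Vx /nesym/eqP fx.
have [C [cC Cx nC]] := zX _ _ fx.
have W1 : nbhs x C by apply: open_nbhs_nbhs; split => //; case: cC.
have W2 : nbhs x (f @^-1` (~` C)).
  apply: cf; apply: open_nbhs_nbhs; split => //; apply: closed_openC.
  by case: cC.
have [U [cU Ux UV]] := clopen_nbhs_basis hX zX cX (filterI Vx (filterI W1 W2)).
exists U; split=> // [y /UV[]//|y /UV[_ [_ nCy]] /UV[_ [Cy _]]]; exact: nCy.
Qed.

End ClopenSets.

Section FiniteAdditivity.
Variables (R : realType) (T : Type) (m : set T -> R).
Hypothesis madd : forall A B, A `&` B = set0 -> m (A `|` B) = m A + m B.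

Lemma charge_set0 : m set0 = 0.
Proof.
have := madd (setI0 set0); rewrite setU0 => /eqP.
by rewrite -subr_eq0 opprD addNKr oppr_eq0 => /eqP.
Qed.

Lemma charge_partition (A : set T) (c : T -> nat) n :
  (forall u, A u -> (c u < n)%N) ->
  m A = \sum_(i < n) m (A `&` [set u | c u = i]).
Proof.
move=> cn.
suff H k : m (A `&` [set u | (c u < k)%N]) =
    \sum_(i < k) m (A `&` [set u | c u = i]).
  rewrite -H; congr m; apply/seteqP.
  by split=> [u Au|u []//]; split => //; exact: cn.
elim: k => [|k IH].
  rewrite big_ord0 -charge_set0; congr m; apply/seteqP; split => u // [].
  by [].
rewrite big_ord_recr /= -IH -madd; last first.
  by apply/seteqP; split => u // -[[_ /= l] [_ /= e]]; rewrite e ltnn in l.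
congr m; apply/seteqP; split=> u /=.
  by move=> [Au]; rewrite ltnS leq_eqVlt => /orP[/eqP e|l]; [right|left].
by case=> -[Au /= cu]; split => //; rewrite ltnS ?cu // ltnW.
Qed.

End FiniteAdditivity.

Section MeanTransfer.
Variables (R : realType) (Gamma : groupType) (X : compactHausdorffType).
Variable phi : top_action Gamma X.
Hypotheses (zdX : zero_dimensional X) (perfectX : forall x : X, ~ open [set x]).
Hypothesis phi_minimal : minimal phi.
Local Notation Gphi := (transformation_groupoid phi).
Local Notation FG := (full_group phi).
Implicit Types (g h : Gamma) (x y : X) (U V W : set X) (u v : Gphi).

Let hX : hausdorff_space X := hausdorff_setT.
Let cX : compact [set: X] := compact_setT.

(** The exchange of a clopen set with a disjoint translate is locally given by
    one of [g], its inverse and the identity. *)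
Lemma swap_full_group g V : clopen V -> (forall x, V x -> ~ V (phi g x)) ->
  exists h : FG, (forall x, V x -> cocycle h x = g) /\
    rigid_stabilizer phi (V `|` [set x | V (phi g^-1%g x)]) h.
Proof.
move=> cV dV.
pose c x := if `[< V x >] then g else
  if `[< V (phi g^-1%g x) >] then g^-1%g else 1%g.
have cK : involutive (fun x => phi (c x) x).
  move=> x; have [Vx|Vx] := pselect (V x).
    have -> : c x = g by rewrite /c asboolT.
    rewrite /c asboolF; last exact: dV.
    have gK : phi g^-1%g (phi g x) = x by rewrite -actM mulVg act1.
    by rewrite gK asboolT // gK.
  have [Vg|Vg] := pselect (V (phi g^-1%g x)).
    have -> : c x = g^-1%g by rewrite /c asboolF // asboolT.
    by rewrite /c asboolT // -actM mulgV act1.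
  have c1 : c x = 1%g by rewrite /c !asboolF.
  by rewrite c1 act1 c1 act1.
have [x|||h hc] := @full_group_of_cocycle _ _ phi c (fun x => phi (c x) x).
- have n1 := near_clopen x cV.
  have n2 : \forall y \near x, V (phi g^-1%g y) = V (phi g^-1%g x).
    exact: (@act_continuous _ _ phi g^-1%g x _ (near_clopen (phi g^-1%g x) cV)).
  by apply: filterS2 n1 n2 => y e1 e2; rewrite /c e1 e2.
- exact: cK.
- exact: cK.
exists h; split=> [x Vx|x /not_orP[n1 n2]]; rewrite hc /c.
  by rewrite asboolT.
by rewrite !asboolF.
Qed.

Definition translate g u : Gphi := ((g * u.1)%g, u.2).

Lemma rng_translate g u : rng (translate g u) = phi g (rng u).
Proof. by rewrite /rng /= actM. Qed.

Lemma translateM g h u : translate (g * h)%g u = translate g (translate h u).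
Proof. by rewrite /translate /= mulgA. Qed.

Lemma translate1 u : translate 1%g u = u.
Proof. by case: u => g x; rewrite /translate mul1g. Qed.

Lemma translate_inj g : injective (translate g).
Proof.
move=> u v e.
by rewrite -(translate1 u) -(translate1 v) -(mulVg g) !translateM e.
Qed.

Section FixMean.
Variables (U : set X) (m : set Gphi -> R).
Hypothesis cU : clopen U.
Hypothesis m_mean :
  mean_on (gact phi) (rigid_stabilizer phi U) (arrows_into phi U) m.

Let m_ge0 A : 0 <= m A. Proof. by case: m_mean. Qed.
Let madd A B : A `&` B = set0 -> m (A `|` B) = m A + m B.
Proof. by case: m_mean => _ _ + _; apply. Qed.
Let m0 : m set0 = 0 := charge_set0 madd.

Lemma mean_swap g V (A : set Gphi) : clopen V ->
  (forall x, V x -> ~ V (phi g x)) ->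
  V `<=` U -> (forall x, V x -> U (phi g x)) -> A `<=` arrows_into phi V ->
  m (translate g @` A) = m A.
Proof.
move=> cV dV VU gVU AV.
have [h [hc Kh]] := swap_full_group cV dV.
have KUh : rigid_stabilizer phi U h.
  apply: sub_rigid Kh => x [/VU//|/= Vx].
  by rewrite -(act1 phi x) -(mulgV g) actM; exact: gVU.
have AU : A `<=` arrows_into phi U by move=> u /AV /VU.
have [_ _ _ inv] := m_mean; rewrite -(inv _ _ KUh AU).
congr m; apply/seteqP; split=> _ [u Au <-]; exists u => //;
  by rewrite /gact hc //; exact: AV.
Qed.

Lemma mean_local_moved g x : U x -> U (phi g x) -> phi g x <> x ->
  exists2 V, nbhs x V &
    forall A, A `<=` arrows_into phi V -> m (translate g @` A) = m A.
Proof.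
move=> Ux Ugx gx.
have n1 : nbhs x (U `&` phi g @^-1` U).
  apply: filterI; last apply: act_continuous; apply: open_nbhs_nbhs;
  by split => //; case: cU.
have [V [cV Vx VU dV]] :=
  displaced_clopen hX zdX cX (@act_continuous _ _ phi g x) n1 gx.
exists V; first by apply: open_nbhs_nbhs; split => //; case: cV.
by move=> A AV; apply: (mean_swap cV) => // y /VU[].
Qed.

(** A partial translation inside U is locally one swap, or a product of two
    swaps near its fixed points; so the mean does not see it. *)
Lemma mean_local g x : U x -> U (phi g x) ->
  exists2 V, nbhs x V &
    forall A, A `<=` arrows_into phi V -> m (translate g @` A) = m A.
Proof.
move=> Ux Ugx.
have [gx|] := pselect (phi g x = x); last exact: mean_local_moved.
have [g' [Ug' g'x]] : exists g', U (phi g' x) /\ phi g' x <> x.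
  have oU' : open (U `\ x).
    rewrite setDE; apply: openI; first by case: cU.
    apply: closed_openC; apply: accessible_closed_set1.
    exact: hausdorff_accessible.
  have [z Uz] : U `\ x !=set0.
    apply: contrapT => /forallNP nz; apply: (@perfectX x).
    suff <- : U = [set x] by case: cU.
    apply/seteqP; split=> [y Uy|_ ->//].
    by apply: contrapT => yx; apply: (nz y).
  have [|y [[Uy yx] [g' _ e]]] := phi_minimal x _ oU'; first by exists z.
  by exists g'; rewrite e.
have [V1 V1x inv1] := mean_local_moved Ux Ug' g'x.
have e : phi (g * g'^-1)%g (phi g' x) = x by rewrite -actM mulgVK.
have [||V2 V2x inv2] := @mean_local_moved (g * g'^-1)%g (phi g' x) Ug'.
- by rewrite e.
- by rewrite e; exact/nesym.
exists (V1 `&` phi g' @^-1` V2).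
  by apply: filterI => //; apply: act_continuous.
move=> A AV; rewrite -(inv1 A); last by move=> u /AV[].
rewrite -(inv2 (translate g' @` A)); last first.
  by move=> _ [u /AV[_ V2u] <-]; rewrite /arrows_into /= rng_translate.
congr m; apply/seteqP; split=> [_ [u Au <-]|_ [_ [u Au <-] <-]].
  by exists (translate g' u); [exists u|rewrite -translateM mulgVK].
by exists u => //; rewrite -translateM mulgVK.
Qed.

(** Partial translations are locally invisible to the mean, and by compactness
    finitely many local pieces suffice. *)
Lemma mean_translate g (A : set Gphi) :
  A `<=` arrows_into phi U -> translate g @` A `<=` arrows_into phi U ->
  m (translate g @` A) = m A.
Proof.
pose W := U `&` phi g @^-1` U.
have cW : clopen W.
  by apply: clopenI => //; apply: clopen_comp => //; exact: act_continuous.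
pose Q V := forall A, A `<=` arrows_into phi (V `&` W) ->
  m (translate g @` A) = m A.
suff QT : Q setT.
  move=> AU gAU; apply: QT => u Au; do 2!split => //; first exact: AU.
  have := gAU (translate g u).
  by rewrite /arrows_into /= rng_translate; apply; exists u.
apply: (compact_ideal cX) => {A}.
- move=> A A0; suff -> : A = set0 by rewrite image_set0.
  by apply/seteqP; split => // u /A0 [].
- move=> V1 V2 Q1 Q2 A AV.
  have AE : A = (A `&` arrows_into phi V1) `|` (A `\` arrows_into phi V1).
    by rewrite setUIDK.
  rewrite AE image_setU !madd; last 2 first.
  + by apply/seteqP; split => // u [[]] _ ? [].
  + apply/seteqP; split => // _ [[u [_ V1u] <-] [v [_ nV1v]]] /translate_inj e.
    by apply: nV1v; rewrite e.
  rewrite Q1 ?Q2 //.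
  + by move=> u [/AV[[]//]].
  + by move=> u [/AV[_ Wu] V1u].
- by move=> V1 V2 V12 Q2 A AV; apply: Q2 => u /AV[/V12].
move=> x _; have [[Ux Ugx]|nW] := pselect (W x).
  have [V Vx inv] := mean_local Ux Ugx.
  by exists V => // A AV; apply: inv => u /AV[].
exists (~` W).
  by apply: open_nbhs_nbhs; split => //; apply: closed_openC; case: cW.
move=> A AW; suff -> : A = set0 by rewrite image_set0.
by apply/seteqP; split => // u /AW [].
Qed.

Lemma finite_cover : U !=set0 ->
  exists gs : seq Gamma, forall x, has (fun g => `[< U (phi g x) >]) gs.
Proof.
move=> U0.
pose Q V := exists gs : seq Gamma, forall x, V x ->
  has (fun g => `[< U (phi g x) >]) gs.
suff [gs Hgs] : Q setT by exists gs => x; exact: Hgs.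
apply: (compact_ideal cX).
- by exists [::].
- move=> A B [s1 H1] [s2 H2]; exists (s1 ++ s2) => x ABx; rewrite has_cat.
  by case: ABx => [/H1 -> //|/H2 ->]; rewrite orbT.
- by move=> A B AB [s Hs]; exists s => x /AB /Hs.
move=> x _; have [|y [Uy [g _ e]]] := phi_minimal x U0; first by case: cU.
exists (phi g @^-1` U).
  by apply: act_continuous; apply: open_nbhs_nbhs; split; [case: cU|rewrite e].
by exists [:: g] => z Uz; rewrite /= orbF; apply/asboolP.
Qed.

(** The mean on the arrows ending in U extends, through a finite cover of the
    space by translates of U, to a translation invariant charge on the whole
    groupoid, whose projection to the group is an invariant mean. *)
Lemma amenable_of_mean : U !=set0 -> amenable R Gamma.
Proof.
move=> U0; have [gs0 cov0] := finite_cover U0.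
(* c x is the index of the first element carrying x into U; as 1 comes first,
   index 0 means that x is already in U *)
pose gs := 1%g :: gs0; pose n := size gs.
pose gg i := nth 1%g gs i.
pose c x := find (fun g => `[< U (phi g x) >]) gs.
have hasc x : has (fun g => `[< U (phi g x) >]) gs by rewrite /= cov0 orbT.
have cn x : (c x < n)%N by rewrite -has_find.
have Uc x : U (phi (gg (c x)) x).
  by apply/asboolP; exact: (nth_find 1%g (hasc x)).
pose C i : set Gphi := [set u | c (rng u) = i].
have CU i (E : set Gphi) : E `<=` C i ->
    translate (gg i) @` E `<=` arrows_into phi U.
  move=> EC _ [u /EC <- <-]; rewrite /arrows_into /= rng_translate; exact: Uc.
have imm (f : Gphi -> Gphi) (d : Gphi -> nat) (E : set Gphi) : injective f ->
    (forall u, d u < n)%N ->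
    m (f @` E) = \sum_(i < n) m (f @` (E `&` [set u | d u = i])).
  move=> fi dn.
  have madd' A B : A `&` B = set0 ->
      m (f @` (A `|` B)) = m (f @` A) + m (f @` B).
    move=> AB; rewrite image_setU madd //.
    apply/seteqP; split => // _ [[u Au <-] [v Bv]].
    by move=> /fi e; have : (A `&` B) u; [split => //; rewrite -e|rewrite AB].
  by rewrite (charge_partition madd' (c := d) (n := n)).
pose M (B : set Gphi) := \sum_(i < n) m (translate (gg i) @` (B `&` C i)).
have Madd A B : A `&` B = set0 -> M (A `|` B) = M A + M B.
  move=> AB; rewrite /M -big_split /=; apply: eq_bigr => i _.
  rewrite setIUl image_setU madd //.
  apply/seteqP; split => // _ [[u [Au _] <-] [v [Bv _]]] /translate_inj e.
  by have : (A `&` B) u; [split => //; rewrite -e|rewrite AB].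
have Mge0 A : 0 <= M A by apply: sumr_ge0.
have Minv g B : M (translate g @` B) = M B.
  have -> : M B = \sum_(j < n) \sum_(i < n) m (translate (gg j) @`
      (B `&` C j `&` [set u | c (phi g (rng u)) = i])).
    apply: eq_bigr => j _.
    by apply: (imm _ (fun u => c (phi g (rng u)))) => //; exact: translate_inj.
  rewrite exchange_big /=; apply: eq_bigr => i _.
  have -> : translate (gg i) @` (translate g @` B `&` C i) =
      translate (gg i * g)%g @` (B `&` [set u | c (phi g (rng u)) = i]).
    apply/seteqP; split=> [_ [_ [[u Bu <-] Cu] <-]|_ [u [Bu cu] <-]].
      exists u; last by rewrite translateM.
      by split => //; move: Cu; rewrite /C /= rng_translate.
    exists (translate g u); last by rewrite translateM.
    by split; [exists u|rewrite /C /= rng_translate].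
  rewrite (imm _ (fun u => c (rng u))) //; last exact: translate_inj.
  apply: eq_bigr => j _.
  set E := _ `&` _ `&` _; pose E' := translate (gg j) @` E.
  have e : translate (gg i * g)%g @` E =
      translate (gg i * g * (gg j)^-1)%g @` E'.
    apply/seteqP; split=> [_ [u Eu <-]|_ [_ [u Eu <-] <-]].
      by exists (translate (gg j) u); [exists u|rewrite -translateM mulgVK].
    by exists u => //; rewrite -translateM mulgVK.
  rewrite [LHS](_ : _ = m E'); first by congr m; rewrite /E' /E setIAC.
  rewrite e; apply: mean_translate; first by apply: CU => u [].
  rewrite -e => _ [u [[_ cu] _] <-].
  by rewrite /arrows_into /= rng_translate actM -cu; exact: Uc.
have MT : 1 <= M setT.
  rewrite /M big_ord_recl /=.
  have -> : m (translate (gg 0) @` (setT `&` C 0)) = 1.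
    have [_ <- _ _] := m_mean; congr m; rewrite setTI.
    have CE u : C 0 u <-> U (rng u).
      rewrite /C /c /= act1; have [?|?] := asboolP (U (rng u)); by split.
    apply/seteqP; split=> [_ [u /CE Uu <-]|u Uu]; first by rewrite translate1.
    by exists u; [exact/CE|rewrite translate1].
  by rewrite lerDl; apply: sumr_ge0.
have MT0 : 0 < M setT by apply: lt_le_trans MT.
exists (fun A => M [set u | A u.1] / M setT); split.
- by move=> A; rewrite divr_ge0 // ltW.
- have -> : [set u : Gphi | [set: Gamma] u.1] = setT by apply/seteqP; split.
  by rewrite divff // gt_eqF.
- move=> A B AB; rewrite -mulrDl -Madd //.
  apply/seteqP; split => // u [Au Bu].
  by have : (A `&` B) u.1 by []; rewrite AB.
- move=> g A.
  suff -> : [set u : Gphi | [set (g * a)%g | a in A] u.1] =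
      translate g @` [set u | A u.1] by rewrite Minv.
  apply/seteqP; split=> [[_ x] /= [a Aa <-]|_ [[a x] /= Aa <-]].
    by exists (a, x).
  by exists a.
Qed.

End FixMean.
End MeanTransfer.

(** * Kesten's criterion relative to an invariant subset *)

Section Esum.
Variables (R : realType) (T : choiceType).
Implicit Types (A B D : set T) (f : T -> R).

Lemma le_esum_subset A B (f : T -> \bar R) : A `<=` B ->
  (\esum_(y in A) f y <= \esum_(y in B) f y)%E.
Proof.
move=> AB; apply: ge_ereal_sup => _ [F [finF FA] <-].
by apply: esum_ge; exists F => //; split => //; exact: subset_trans AB.
Qed.

Lemma esumZ D (c : R) f : 0 <= c -> (forall y, 0 <= f y) ->
  (\esum_(y in D) (c * f y)%:E = c%:E * \esum_(y in D) (f y)%:E)%E.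
Proof.
have le (k : R) g : 0 <= k -> (forall y, 0 <= g y) ->
    (\esum_(y in D) (k * g y)%:E <= k%:E * \esum_(y in D) (g y)%:E)%E.
  move=> k0 g0; apply: ge_ereal_sup => _ [A [finA AD] <-].
  have -> : (\sum_(y \in A) (k * g y)%:E = k%:E * \sum_(y \in A) (g y)%:E)%E.
    rewrite !fsbig_finite //= ge0_sume_distrr; last first.
      by move=> y _; rewrite lee_fin.
    by apply: eq_bigr => y _; rewrite EFinM.
  apply: lee_pmul => //; first by apply: fsume_ge0 => y _; rewrite lee_fin.
  by apply: esum_ge; exists A.
move=> c0 f0; have [->|cn0] := eqVneq c 0.
  by rewrite mul0e esum1 // => y _; rewrite mul0r.
have cp : 0 < c by rewrite lt_def cn0.
apply/eqP; rewrite eq_le le //= -lee_pdivlMl //.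
have ci : 0 <= c^-1 by rewrite invr_ge0.
have := le c^-1 (fun y => c * f y) ci (fun y => mulr_ge0 c0 (f0 y)).
by under eq_esum do rewrite mulKf //.
Qed.

End Esum.

Lemma ultra_cvg (R : realType) (W : Type) (F : set_system W) (g : W -> R) :
  UltraFilter F -> (\forall w \near F, 0 <= g w <= 1) ->
  exists p : R, g @ F --> p.
Proof.
move=> FU g01; have FP : ProperFilter F := ultra_proper.
have FI : (g @ F) `[0, 1]%classic.
  by apply: filterS g01 => w; rewrite /= in_itv.
have [p [_ clp]] := segment_compact _ FI.
exists p => V Vp; have [//|FnV] := in_ultra_setVsetC (g @^-1` V) FU.
by have [y [nVy Vy]] := clp (~` V) V FnV Vp.
Qed.

Section Kesten.
Variables (R : realType) (G : groupType) (T : choiceType) (a : G -> T -> T).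
Hypotheses (a1 : forall y, a 1%g y = y)
  (aM : forall g h y, a (g * h)%g y = a g (a h y)).
Variables (K : set G) (D : set T).
Hypotheses (K1 : K 1%g) (KM : forall g h, K g -> K h -> K (g * h)%g)
  (KV : forall g, K g -> K g^-1%g)
  (aD : forall g y, K g -> D y -> D (a g y)).
Implicit Types (F : T -> R) (S L : seq G) (A B : set T).

Lemma actionK g y : a g^-1%g (a g y) = y.
Proof. by rewrite -aM mulVg a1. Qed.

Lemma actionVK g y : a g (a g^-1%g y) = y.
Proof. by rewrite -aM mulgV a1. Qed.

Lemma action_inj g : injective (a g).
Proof. by move=> x y e; rewrite -(actionK g x) e actionK. Qed.

Lemma esum_action g (f : T -> \bar R) : K g ->
  (\esum_(y in D) f (a g y) = \esum_(y in D) f y)%E.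
Proof.
move=> Kg; rewrite [RHS](reindex_esum D _ (a g)) //; split.
- by move=> y Dy; exact: aD.
- by move=> x y _ _; exact: action_inj.
- move=> y Dy; exists (a g^-1%g y); last by rewrite /= actionVK.
  by apply: aD => //; exact: KV.
Qed.

(** Reiter's condition for the action on [D]. *)
Definition almost_invariant S (e : R) (w : T -> R) :=
  [/\ forall y, 0 <= w y,
      (\esum_(y in D) (w y)%:E = 1)%E &
      forall s, s \in S ->
        (\esum_(y in D) `|w (a s^-1%g y) - w y|%:E <= e%:E)%E].

Let mass (A : set T) (w : T -> R) : R := fine (\esum_(y in A `&` D) (w y)%:E).

Let mass_fin S e w A : almost_invariant S e w ->
  (\esum_(y in A `&` D) (w y)%:E = (mass A w)%:E)%E /\ 0 <= mass A w <= 1.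
Proof.
case=> w0 w1 _.
have le1 : (\esum_(y in A `&` D) (w y)%:E <= 1)%E.
  by rewrite -w1; apply: le_esum_subset; exact: subIsetr.
have ge0 : (0 <= \esum_(y in A `&` D) (w y)%:E)%E.
  by apply: esum_ge0 => y _; rewrite lee_fin.
have fn : \esum_(y in A `&` D) (w y)%:E \is a fin_num.
  by rewrite ge0_fin_numE // (le_lt_trans le1) // ltry.
by rewrite /mass fineK // -!lee_fin fineK // ge0 le1.
Qed.

Let mass_shift S e w k A : almost_invariant S e w -> k^-1%g \in S ->
  A `<=` D -> K k -> `|mass (a k @` A) w - mass A w| <= e.
Proof.
move=> ai kS AD Kk; have [w0 w1 wS] := ai.
have [eA A01] := mass_fin A ai.
have [ekA kA01] := mass_fin (a k @` A) ai.
have AI : A `&` D = A.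
  by apply/seteqP; split=> [y []//|y Ay]; split => //; exact: AD.
have kAI : a k @` A `&` D = a k @` A.
  apply/seteqP; split=> [y []//|_ [y Ay <-]]; split; first by exists y.
  by apply: aD => //; exact: AD.
rewrite AI in eA; rewrite kAI esum_image in ekA; last first.
  by move=> x y _ _; exact: action_inj.
have := wS _ kS; rewrite invgK => wk.
have wkA : (\esum_(y in A) `|w (a k y) - w y|%:E <= e%:E)%E.
  exact: le_trans (le_esum_subset _ AD) wk.
rewrite ler_distl; apply/andP; split.
  rewrite lerBlDr -lee_fin EFinD -ekA -eA.
  apply: le_trans (leeD2l _ wkA); rewrite -esumD; last 2 first.
  - by move=> y _; rewrite lee_fin.
  - by move=> y _; rewrite lee_fin.
  by apply: le_esum => y _; rewrite -EFinD lee_fin -lerBlDl distrC ler_norm.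
rewrite -lee_fin EFinD -ekA -eA.
apply: le_trans (leeD2l _ wkA); rewrite -esumD; last 2 first.
- by move=> y _; rewrite lee_fin.
- by move=> y _; rewrite lee_fin.
by apply: le_esum => y _; rewrite -EFinD lee_fin -lerBlDl ler_norm.
Qed.

(** The mean is the limit of the weights along an ultrafilter that contains,
    for each finite [S] and each [e], the weights almost invariant for them. *)
Lemma mean_of_almost_invariant :
  (forall S (e : R), (forall s, s \in S -> K s) -> 0 < e ->
     exists w, almost_invariant S e w) ->
  exists m : set T -> R, mean_on a K D m.
Proof.
move=> ai.
pose I := [set p : seq G * R | (forall s, s \in p.1 -> K s) /\ 0 < p.2].
pose B (p : seq G * R) := [set w | almost_invariant p.1 p.2 w].
have FF : Filter (filter_from I B).
  apply: filter_from_filter; first by exists ([::], 1); split.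
  move=> [S1 e1] [S2 e2] [/= S1K e1p] [/= S2K e2p].
  exists (S1 ++ S2, Num.min e1 e2).
    split; last by rewrite /= lt_min e1p.
    by move=> s /=; rewrite mem_cat => /orP[/S1K|/S2K].
  move=> w [/= w0 w1 wS]; split; split=> //= s sS.
    apply: le_trans (wS s _) _; first by rewrite mem_cat sS.
    by rewrite lee_fin ge_min lexx.
  apply: le_trans (wS s _) _; first by rewrite mem_cat sS orbT.
  by rewrite lee_fin ge_min lexx orbT.
have FP : ProperFilter (filter_from I B).
  by apply: filter_from_proper => -[S e] [/= SK e0]; exact: ai.
have [U [UU FU]] := ultraFilterLemma FP.
have UP : ProperFilter U := ultra_proper.
have Uai S e : (forall s, s \in S -> K s) -> 0 < e ->
    \forall w \near U, almost_invariant S e w.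
  by move=> SK e0; apply: FU; exists (S, e).
have Uai0 : \forall w \near U, almost_invariant [::] 1 w by apply: Uai.
have lim A : {p : R | mass A @ U --> p}.
  apply: cid; apply: ultra_cvg; apply: filterS Uai0 => w.
  by case/(mass_fin A).
pose m A := projT1 (lim A).
have mP A : mass A @ U --> m A := projT2 (lim A).
have mE A (g : (T -> R) -> R) p : (\forall w \near U, g w = mass A w) ->
    g @ U --> p -> p = m A.
  move=> gE gp; apply: (cvg_unique (@Rhausdorff R)) (mP A).
  by apply: cvg_trans gp; apply: near_eq_cvg; apply: filterS gE => w ->.
exists m; split.
- move=> A; apply: cvgr_to_ge (mP A) _; apply: filterS Uai0 => w.
  by case/(mass_fin A) => _ /andP[].
- apply/esym; apply: (mE _ (fun=> 1)); last exact: cvg_cst.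
  by apply: filterS Uai0 => w [_ w1 _]; rewrite /mass setIid w1.
- move=> A B' AB; apply/esym.
  apply: (mE _ (fun w => mass A w + mass B' w)); last first.
    exact: cvgD (mP A) (mP B').
  apply: filterS Uai0 => w ai0; apply: EFin_inj; rewrite EFinD.
  have [<- _] := mass_fin A ai0; have [<- _] := mass_fin B' ai0.
  have [<- _] := mass_fin (A `|` B') ai0.
  have [w0 _ _] := ai0.
  rewrite (esumID A ((A `|` B') `&` D)); last by move=> y _; rewrite lee_fin.
  congr (_ + _)%E; congr esum; apply/seteqP; split=> y.
  - by move=> [Ay Dy]; split=> //; split=> //; left.
  - by move=> [[_ Dy] Ay].
  - move=> [By Dy]; split; first by split => //; right.
    by move=> Ay; have : (A `&` B') y by []; rewrite AB.
  - by move=> [[[]]].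
- move=> k A Kk AD; apply/esym.
  have d0 : (fun w => mass A w - mass (a k @` A) w) @ U --> 0.
    apply/cvgr0Pnorm_le => e e0.
    have Se : forall s, s \in [:: k^-1%g] -> K s.
      by move=> s; rewrite inE => /eqP ->; exact: KV.
    apply: filterS (Uai _ e Se e0) => w ai0; rewrite distrC.
    by apply: mass_shift ai0 _ _ _ => //; rewrite inE.
  have := cvgD d0 (mP (a k @` A)); rewrite add0r => H.
  apply/esym/mE/H; apply: filterE => w.
  by rewrite /= subrK.
Qed.

Definition sqsum F := (\esum_(y in D) (F y ^+ 2)%:E)%E.

Definition average L F y := (size L)%:R^-1 * \sum_(s <- L) F (a s^-1%g y).

Lemma sqsum_ge0 F : (0 <= sqsum F)%E.
Proof. by apply: esum_ge0 => y _; rewrite lee_fin sqr_ge0. Qed.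

(** Reiter's condition fails for some [S] and [e], in particular for the
    probability weight proportional to [F ^+ 2]. *)
Lemma no_mean_sq : ~ (exists m : set T -> R, mean_on a K D m) ->
  exists S, exists e : R, [/\ forall s, s \in S -> K s, 0 < e &
    forall F, (sqsum F < +oo)%E ->
      (e%:E * sqsum F <=
       \sum_(s <- S) \esum_(y in D) `|F (a s^-1%g y) ^+ 2 - F y ^+ 2|%:E)%E].
Proof.
move=> nomean; apply: contrapT => none; apply: nomean.
apply: mean_of_almost_invariant => S e SK e0; apply: contrapT => noai.
apply: none; exists S, e; split => // F Ffin.
have F0 := sqsum_ge0 F.
have sum_ge0 : (0 <= \sum_(s <- S) \esum_(y in D)
    `|F (a s^-1%g y) ^+ 2 - F y ^+ 2|%:E)%E.
  by apply: sume_ge0 => s _; apply: esum_ge0 => y _; rewrite lee_fin.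
have [r Fr] : exists r, sqsum F = r%:E.
  by exists (fine (sqsum F)); rewrite fineK // ge0_fin_numE.
have r0 : 0 <= r by rewrite -lee_fin -Fr.
rewrite Fr; have [->|rn0] := eqVneq r 0; first by rewrite mule0.
have rp : 0 < r by rewrite lt_def rn0.
have ri : 0 <= r^-1 by rewrite invr_ge0.
apply: contrapT => /negP; rewrite -ltNge => small; apply: noai.
exists (fun y => r^-1 * F y ^+ 2); split.
- by move=> y; rewrite mulr_ge0 ?sqr_ge0.
- rewrite esumZ //; last by move=> y; exact: sqr_ge0.
  by rewrite -/(sqsum F) Fr -EFinM mulVf.
- move=> s sS.
  under eq_esum do rewrite -mulrBr normrM (ger0_norm ri).
  rewrite esumZ // lee_pdivrMl // muleC.
  apply: le_trans (ltW small); rewrite (big_rem _ sS) /= leeDl //.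
  by apply: sume_ge0 => s' _; apply: esum_ge0 => y _; rewrite lee_fin.
Qed.

Lemma sqsum_averageM L L' F :
  average [seq (s * r)%g | s <- L, r <- L'] F = average L (average L' F).
Proof.
apply/funext => y; rewrite /average size_allpairs natrM invfM -mulrA.
congr (_ * _); rewrite -big_distrr /=; congr (_ * _).
rewrite big_allpairs_dep /=; apply: eq_bigr => s _; apply: eq_bigr => r _.
by rewrite invgM aM.
Qed.

Lemma mean_sqr_le (I : Type) (s : seq I) (f : I -> R) : (0 < size s)%N ->
  ((size s)%:R^-1 * \sum_(i <- s) f i) ^+ 2 <=
    (size s)%:R^-1 * \sum_(i <- s) f i ^+ 2.
Proof.
move=> s0; set n := (size s)%:R; set t := \sum_(i <- s) f i.
have n0 : 0 < n :> R by rewrite ltr0n.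
have : 0 <= n^-1 * \sum_(i <- s) (f i - n^-1 * t) ^+ 2.
  by rewrite mulr_ge0 ?invr_ge0 ?(ltW n0) // sumr_ge0 // => i _; exact: sqr_ge0.
have -> : \sum_(i <- s) (f i - n^-1 * t) ^+ 2 =
    \sum_(i <- s) f i ^+ 2 - n^-1 * t ^+ 2.
  under eq_bigr do rewrite sqrrB.
  rewrite big_split sumrB /= sumrMnl -mulr_suml -/t.
  rewrite big_const_seq count_predT iter_addr_0 -mulr_natl -/n.
  by field; rewrite gt_eqF.
have -> : (n^-1 * t) ^+ 2 = n^-1 * (n^-1 * t ^+ 2) by ring.
by rewrite mulrBr subr_ge0.
Qed.

(** A function whose norm is barely decreased by averaging the operators
    [(1 + s) / 2] is almost fixed by every [s], by the parallelogram identity,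
    and then its square would satisfy Reiter's condition. *)
Lemma average_contraction : ~ (exists m : set T -> R, mean_on a K D m) ->
  exists L, exists c : R, [/\ forall s, s \in L -> K s, (0 < size L)%N,
    0 <= c < 1 & forall F, (sqsum F < +oo)%E ->
      (sqsum (average L F) <= c%:E * sqsum F)%E].
Proof.
move=> /no_mean_sq[S0 [e [S0K e0 He0]]].
(* the identity is added to make the list nonempty *)
pose S := 1%g :: S0; pose n : R := (size S)%:R.
have SK s : s \in S -> K s by rewrite inE => /orP[/eqP ->|/S0K].
have n0 : 0 < n by rewrite ltr0n.
have He F : (sqsum F < +oo)%E -> (e%:E * sqsum F <=
    \sum_(s <- S) \esum_(y in D) `|F (a s^-1%g y) ^+ 2 - F y ^+ 2|%:E)%E.
  move=> Ff; apply: le_trans (He0 F Ff) _; rewrite big_cons leeDr //.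
  by apply: esum_ge0 => y _; rewrite lee_fin.
(* averaging over L is averaging the operators (1 + s) / 2 over S *)
pose L := S ++ nseq (size S) 1%g.
have sL : (size L)%:R = 2 * n :> R by rewrite size_cat size_nseq natrD /n; ring.
pose c := Num.max 0 (1 - e ^+ 2 / (16 * n ^+ 2)).
exists L, c; split.
- by move=> s; rewrite mem_cat mem_nseq => /orP[/SK//|/andP[_ /eqP ->]].
- by rewrite size_cat addSn.
- rewrite /c le_max lexx /= gt_max ltr01 /= ltrBlDr ltrDl.
  by rewrite divr_gt0 ?exprn_gt0 // mulr_gt0 ?exprn_gt0.
move=> F Ff.
have [r Fr] : exists r, sqsum F = r%:E.
  by exists (fine (sqsum F)); rewrite fineK // ge0_fin_numE // sqsum_ge0.
have r0 : 0 <= r by rewrite -lee_fin -Fr sqsum_ge0.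
pose d y := \sum_(s <- S) (F (a s^-1%g y) - F y) ^+ 2.
pose q y := \sum_(s <- S) (F (a s^-1%g y) ^+ 2 + F y ^+ 2).
have d0 y : 0 <= d y by apply: sumr_ge0 => s _; exact: sqr_ge0.
have q0 y : 0 <= q y by apply: sumr_ge0 => s _; rewrite addr_ge0 ?sqr_ge0.
have sumq : (\esum_(y in D) (q y)%:E = (2 * n * r)%:E)%E.
  under eq_esum do rewrite /q -sumEFin.
  rewrite esum_sum; last by move=> y s _ _; rewrite lee_fin addr_ge0 ?sqr_ge0.
  rewrite big_seq (eq_bigr (fun=> (2 * r)%:E)) => [|s sS].
    rewrite -big_seq sumEFin big_const_seq count_predT iter_addr_0 -/S.
    by rewrite -mulr_natl -/n; congr (_%:E); ring.
  under eq_esum do rewrite EFinD.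
  rewrite esumD; try by move=> y _; rewrite lee_fin sqr_ge0.
  rewrite (esum_action (fun y => (F y ^+ 2)%:E)); last exact: KV (SK _ sS).
  by rewrite -/(sqsum F) Fr -EFinD; congr (_%:E); ring.
(* the parallelogram identity, summed over S *)
have pt1 y : average L F y ^+ 2 + (4 * n)^-1 * d y <= (2 * n)^-1 * q y.
  have -> : average L F y = n^-1 * \sum_(s <- S) ((F (a s^-1%g y) + F y) / 2).
    rewrite /average sL big_cat big_nseq /= invg1 a1 iter_addr_0.
    rewrite -mulr_suml big_split /= big_const_seq count_predT iter_addr_0.
    by rewrite -mulrS -[(size S0).+1]/(size S) invfM; ring.
  have := @mean_sqr_le _ S (fun s => (F (a s^-1%g y) + F y) / 2) isT.
  rewrite -/n => H; apply: (le_trans (lerD H (lexx _))).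
  rewrite /d /q le_eqVlt; apply/orP; left; apply/eqP.
  have -> : (4 * n)^-1 * \sum_(s <- S) (F (a s^-1%g y) - F y) ^+ 2 =
      n^-1 * \sum_(s <- S) (4^-1 * (F (a s^-1%g y) - F y) ^+ 2).
    by rewrite -mulr_sumr invfM; ring.
  rewrite -mulrDr -big_split /=.
  have -> : (2 * n)^-1 = n^-1 * 2^-1 by rewrite invfM mulrC.
  rewrite -mulrA; congr (_ * _); rewrite mulr_sumr; apply: eq_bigr => s _.
  by field.
(* the weight in the inequality between the arithmetic and geometric means,
   small enough for the terms in F to absorb only half of e *)
pose th := e / (4 * n).
have th0 : 0 < th by rewrite divr_gt0 // mulr_gt0.
have pt2 y : \sum_(s <- S) `|F (a s^-1%g y) ^+ 2 - F y ^+ 2| <=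
    (2 * th)^-1 * d y + th * q y.
  rewrite /d /q !mulr_sumr -big_split /=; apply: ler_sum => s _.
  set u := F _; set v := F y.
  have uv : u ^+ 2 - v ^+ 2 = (u - v) * (u + v) by ring.
  have H : `|u - v| * `|u + v| <=
      (2 * th)^-1 * (u - v) ^+ 2 + (th / 2) * (u + v) ^+ 2.
    rewrite -subr_ge0 -(real_normK (num_real (u - v))).
    rewrite -(real_normK (num_real (u + v))).
    have -> : (2 * th)^-1 * `|u - v| ^+ 2 + th / 2 * `|u + v| ^+ 2 -
        `|u - v| * `|u + v| = (2 * th)^-1 * (`|u - v| - th * `|u + v|) ^+ 2.
      by field; rewrite gt_eqF.
    by rewrite mulr_ge0 ?sqr_ge0 // invr_ge0 mulr_ge0 // ltW.
  rewrite uv normrM; apply: (le_trans H); rewrite lerD2l.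
  rewrite -subr_ge0.
  have -> : th * (u ^+ 2 + v ^+ 2) - th / 2 * (u + v) ^+ 2 =
    th / 2 * (u - v) ^+ 2 by field.
  by rewrite mulr_ge0 ?sqr_ge0 // divr_ge0 // ltW.
have n4 : 0 <= (4 * n)^-1 by rewrite invr_ge0 mulr_ge0 // ltW.
have n2 : 0 <= (2 * n)^-1 by rewrite invr_ge0 mulr_ge0 // ltW.
have t2 : 0 <= (2 * th)^-1 by rewrite invr_ge0 mulr_ge0 // ltW.
have sum1 : (sqsum (average L F) +
    (4 * n)^-1%:E * (\esum_(y in D) (d y)%:E) <= r%:E)%E.
  rewrite -esumZ // -esumD; last 2 first.
  - by move=> y _; rewrite lee_fin sqr_ge0.
  - by move=> y _; rewrite lee_fin mulr_ge0.
  have -> : r = (2 * n)^-1 * (2 * n * r) by field; rewrite gt_eqF.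
  rewrite EFinM -sumq -esumZ //; apply: le_esum => y _.
  by rewrite -EFinD lee_fin.
have sum2 : ((e * r)%:E <= (2 * th)^-1%:E * (\esum_(y in D) (d y)%:E) +
    (th * (2 * n * r))%:E)%E.
  rewrite EFinM -Fr; apply: le_trans (He F Ff) _.
  rewrite -esum_sum; last by move=> *; rewrite lee_fin.
  rewrite [in leRHS]EFinM -sumq -!esumZ // ?(ltW th0) // -esumD; last 2 first.
  - by move=> y _; rewrite lee_fin mulr_ge0.
  - by move=> y _; rewrite lee_fin mulr_ge0 // ltW.
  by apply: le_esum => y _; rewrite sumEFin -EFinD lee_fin.
have Z0 : (0 <= \esum_(y in D) (d y)%:E)%E.
  by apply: esum_ge0 => y _; rewrite lee_fin.
have A0 := sqsum_ge0 (average L F).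
have n40 : 0 < 4 * n by rewrite mulr_gt0.
have cZ0 : (0 <= (4 * n)^-1%:E * (\esum_(y in D) (d y)%:E))%E.
  by rewrite mule_ge0 // lee_fin.
have [p Ep] : exists p, sqsum (average L F) = p%:E.
  exists (fine (sqsum (average L F))); rewrite fineK // ge0_fin_numE //.
  by apply: le_lt_trans (ltry r); apply: le_trans sum1; rewrite leeDl.
have [z Ez] : exists z, (\esum_(y in D) (d y)%:E)%E = z%:E.
  exists (fine (\esum_(y in D) (d y)%:E)%E); rewrite fineK // ge0_fin_numE //.
  apply: le_lt_trans (ltry (4 * n * r)); rewrite EFinM -lee_pdivrMl //.
  by apply: le_trans sum1; rewrite leeDr.
move: sum1 sum2; rewrite Fr Ep Ez -!EFinM -!EFinD !lee_fin => sum1 sum2.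
have cr : (1 - e ^+ 2 / (16 * n ^+ 2)) * r <= c * r.
  by rewrite ler_wpM2r // /c le_max lexx orbT.
apply: le_trans cr.
have Zge : e ^+ 2 * r / (16 * n ^+ 2) <= (4 * n)^-1 * z.
  have -> : e ^+ 2 * r / (16 * n ^+ 2) =
      e / (8 * n ^+ 2) * (e * r - th * (2 * n * r)).
    by rewrite /th; field; rewrite gt_eqF.
  have -> : (4 * n)^-1 * z = e / (8 * n ^+ 2) * ((2 * th)^-1 * z).
    by rewrite /th; field; rewrite !gt_eqF.
  rewrite ler_wpM2l ?lerBlDr // divr_ge0 ?(ltW e0) // mulr_ge0 //.
  exact: sqr_ge0.
by lra.
Qed.

(** The averages of the previous lemma are iterated: a product of averages is
    the average over the products. *)
Lemma average_small : ~ (exists m : set T -> R, mean_on a K D m) ->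
  forall e : R, 0 < e ->
  exists L, [/\ forall s, s \in L -> K s, (0 < size L)%N &
    forall F, (sqsum F < +oo)%E ->
      (sqsum (average L F) <= e%:E * sqsum F)%E].
Proof.
move=> /average_contraction[L [c [LK L0 /andP[c0 c1] Hc]]] e e0.
have [n cn] : exists n, c ^+ n <= e.
  have /cvgrPdist_le/(_ e e0)[n _ Hn] : (fun n => c ^+ n) @ \oo --> (0 : R).
    by apply: cvg_expr; rewrite ger0_norm.
  exists n; have := Hn n (leqnn n); rewrite /= sub0r normrN.
  by rewrite ger0_norm // exprn_ge0.
suff [L' [L'K L'0 HL']] : exists L',
    [/\ forall s, s \in L' -> K s, (0 < size L')%N &
    forall F, (sqsum F < +oo)%E ->
      (sqsum (average L' F) <= (c ^+ n)%:E * sqsum F)%E].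
  exists L'; split=> // F Ff; apply: le_trans (HL' F Ff) _.
  by rewrite lee_wpmul2r ?sqsum_ge0 // lee_fin.
elim: n {cn} => [|n [L' [L'K L'0 HL']]].
  exists [:: 1%g]; split=> // [s|F _]; first by rewrite inE => /eqP ->.
  rewrite expr0 mul1e le_eqVlt; apply/orP; left; apply/eqP; congr sqsum.
  by apply/funext => y; rewrite /average /= big_seq1 invr1 mul1r invg1 a1.
exists [seq (s * r)%g | s <- L, r <- L']; split.
- by move=> _ /allpairsP[[s r] /= [/LK Ks /L'K Kr ->]]; exact: KM.
- by rewrite size_allpairs muln_gt0 L0.
move=> F Ff; rewrite sqsum_averageM.
have Ff' : (sqsum (average L' F) < +oo)%E.
  apply: le_lt_trans (HL' F Ff) _.
  by rewrite lte_mul_pinfty // lee_fin exprn_ge0.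
apply: le_trans (Hc _ Ff') _.
by rewrite exprS EFinM -muleA lee_wpmul2l // ?lee_fin // HL'.
Qed.

End Kesten.

(** * Averages of conjugates in the regular representation *)

Section RegularRepresentation.
Variables (R : realType) (G : groupType).
Local Notation C := R[i].
Local Notation H := (l2 R G).
Local Notation normc := ComplexField.Normc.normc.
Implicit Types (g h k s t : G) (f : H) (S T : H -> H) (L : seq G).

Lemma l2P (f f' : H) : (forall x : G, f x = f' x) -> f = f'.
Proof. by move=> e; apply: val_inj; apply/funext. Qed.

Lemma left_regular_is_linear g : linear (@left_regular R G g).
Proof. by move=> c f f'; apply: l2P. Qed.

HB.instance Definition _ g := GRing.isLinear.Build C H H _ (@left_regular R G g)
  (left_regular_is_linear g).

Lemma left_regularM g h f :
  left_regular (g * h)%g f = left_regular g (left_regular h f).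
Proof. by apply: l2P => x; rewrite /= invgM mulgA. Qed.

Lemma left_regular1 f : left_regular 1%g f = f.
Proof. by apply: l2P => x; rewrite /= invg1 mul1g. Qed.

Lemma l2_normE f : `|f| = (l2norm f)%:C. Proof. by []. Qed.

Lemma norm_left_regular g f : `|left_regular g f| = `|f|.
Proof.
rewrite !l2_normE; congr (_%:C); rewrite /l2norm; congr (Num.sqrt (fine _)).
rewrite /sqnorm [RHS](reindex_esum [set: G] [set: G] (fun x => (g^-1 * x)%g)) //.
split=> //; first by move=> x y _ _ /mulgI.
by move=> x _; exists (g * x)%g; rewrite // mulKg.
Qed.

Lemma opnorm_leD S T (c d : R) : opnorm_le S c -> opnorm_le T d ->
  opnorm_le (S + T) (c + d).
Proof.
move=> Sc Td f; rewrite rmorphD mulrDl.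
by apply: le_trans (ler_normD _ _) _; rewrite lerD.
Qed.

Lemma opnorm_leZ (z : C) T (c : R) : opnorm_le T c ->
  opnorm_le (z *: T) (normc z * c).
Proof.
move=> Tc f; rewrite [(z *: T) f]/(z *: T f) normrZ rmorphM -mulrA.
by case: z => a b; rewrite ler_wpM2l.
Qed.

Lemma opnorm_le_sum (I : eqType) (r : seq I) (T : I -> H -> H) (c : I -> R) :
  (forall i, i \in r -> opnorm_le (T i) (c i)) ->
  opnorm_le (\sum_(i <- r) T i) (\sum_(i <- r) c i).
Proof.
elim: r => [|i r IH] Tc.
  by rewrite !big_nil => f; rewrite mul0r normr0.
rewrite !big_cons; apply: opnorm_leD; first by apply: Tc; rewrite mem_head.
by apply: IH => j jr; apply: Tc; rewrite in_cons jr orbT.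
Qed.

(** The averages of Powers, over a list counted with multiplicities. They are
    defined on all operators because they apply both to a translation and to an
    element of an ideal. *)
Definition twirl L T : H -> H := fun f =>
  (size L)%:R^-1 *: \sum_(s <- L) left_regular s (T (left_regular s^-1%g f)).

Lemma twirlE L T f : twirl L T f =
  (size L)%:R^-1 *: \sum_(s <- L) left_regular s (T (left_regular s^-1%g f)).
Proof. by []. Qed.

Lemma twirl_opnorm L T (c : R) : (0 < size L)%N -> opnorm_le T c ->
  opnorm_le (twirl L T) c.
Proof.
move=> L0 Tc f.
have n0 : (size L)%:R != 0 :> C by rewrite pnatr_eq0 -lt0n.
rewrite normrZ normfV normr_nat.
rewrite ler_pdivrMl ?ltr0n //.
apply: le_trans (ler_norm_sum _ _ _) _.
have -> : (size L)%:R * (c%:C * `|f|) = \sum_(s <- L) (c%:C * `|f|).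
  by rewrite big_const_seq count_predT iter_addr_0 mulr_natl.
apply: ler_sum => s _; rewrite norm_left_regular.
by apply: le_trans (Tc _) _; rewrite norm_left_regular.
Qed.

Lemma twirlM L L' T :
  twirl [seq (s * r)%g | s <- L, r <- L'] T = twirl L (twirl L' T).
Proof.
apply/funext => f; rewrite !twirlE size_allpairs natrM invfM -scalerA.
congr (_ *: _); rewrite scaler_sumr big_allpairs_dep; apply: eq_bigr => s _.
rewrite linearZ -scaler_sumr; congr (_ *: _); rewrite linear_sum.
by apply: eq_bigr => r _; rewrite invgM !left_regularM.
Qed.

Lemma twirlC L L' T : (forall s r, s \in L -> r \in L' -> (s * r = r * s)%g) ->
  twirl L (twirl L' T) = twirl L' (twirl L T).
Proof.
move=> LL'; rewrite -!twirlM; apply/funext => f; rewrite !twirlE.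
rewrite !size_allpairs mulnC; congr (_ *: _).
rewrite !big_allpairs_dep /= exchange_big /= big_seq [RHS]big_seq.
apply: eq_bigr => r rL'; rewrite big_seq [RHS]big_seq.
by apply: eq_bigr => s sL; rewrite LL'.
Qed.

Lemma twirlD L S T : twirl L (S + T) = twirl L S + twirl L T.
Proof.
apply/funext => f; transitivity (twirl L S f + twirl L T f); last by [].
rewrite !twirlE -scalerDr.
congr (_ *: _); rewrite -big_split /=; apply: eq_bigr => s _.
by rewrite -linearD.
Qed.

Lemma twirlZ L (z : C) T : twirl L (z *: T) = z *: twirl L T.
Proof.
apply/funext => f; transitivity (z *: twirl L T f); last by [].
rewrite !twirlE scalerA mulrC -scalerA.
congr (_ *: _); rewrite scaler_sumr; apply: eq_bigr => s _.
by rewrite -linearZ.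
Qed.

Lemma twirl1 L : (0 < size L)%N -> twirl L id = id.
Proof.
move=> L0; apply/funext => f; rewrite twirlE.
under eq_bigr do rewrite -left_regularM mulgV left_regular1.
rewrite big_const_seq count_predT iter_addr_0 -(scaler_nat _ f).
rewrite scalerA mulVf ?scale1r //.
by rewrite pnatr_eq0 -lt0n.
Qed.

Lemma twirl_sum L (I : Type) (r : seq I) (T : I -> H -> H) :
  twirl L (\sum_(i <- r) T i) = \sum_(i <- r) twirl L (T i).
Proof.
elim: r => [|i r IH]; last by rewrite !big_cons twirlD IH.
by rewrite !big_nil -(scale0r (0 : H -> H)) twirlZ !scale0r.
Qed.

End RegularRepresentation.

(** * Powers averaging implies simplicity *)

Section PowersAveraging.
Variables (R : realType) (G : groupType).
Local Notation C := R[i].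
Local Notation H := (l2 R G).
Local Notation normc := ComplexField.Normc.normc.
Implicit Types (g h k s t x : G) (f : H) (S T : H -> H) (L : seq G).

Lemma complex_normE (z : C) : `|z| = (normc z)%:C. Proof. by case: z. Qed.

Lemma normc_ge0 (z : C) : 0 <= normc z.
Proof. by case: z => a b; exact: sqrtr_ge0. Qed.

Lemma norm_coef_le f x : normc (f x) <= l2norm f.
Proof.
rewrite -ler_sqr ?nnegrE ?normc_ge0 ?l2norm_ge0 // -lee_fin -sqnormE.
by apply: esum_ge; exists [set x]; [split|rewrite fsbig_set1].
Qed.

Definition delta_fun g (x : G) : C^o := (x == g)%:R.

Lemma sqnorm_delta g : sqnorm (delta_fun g) = 1%E.
Proof.
rewrite /sqnorm; transitivity (\esum_(x in [set g]) (1 : \bar R))%E.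
  rewrite [RHS]esum_mkcond; apply: eq_esum => x _; rewrite /delta_fun.
  have [->|xg] := eqVneq x g.
    by rewrite mem_set // ComplexField.Normc.normc1 expr1n.
  rewrite memNset ?ComplexField.Normc.normc0 ?expr0n // => /eqP.
  by rewrite (negPf xg).
by rewrite esum_set1.
Qed.

Lemma delta_l2 g : delta_fun g \in @l2_pred R G.
Proof. by rewrite inE sqnorm_delta ltry. Qed.

Definition delta g : H := L2 (delta_l2 g).

Lemma norm_delta g : l2norm (delta g) = 1.
Proof. by rewrite /l2norm sqnorm_delta sqrtr1. Qed.

Lemma left_regular_delta g h : left_regular g (delta h) = delta (g * h)%g.
Proof.
apply: l2P => x; rewrite /= /delta_fun; congr (_%:R); congr nat_of_bool.
by apply/eqP/eqP => [<-|->]; rewrite ?mulKg ?mulVKg.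
Qed.

Lemma l2_sumE (I : Type) (r : seq I) (u : I -> H) x :
  (\sum_(i <- r) u i) x = \sum_(i <- r) u i x.
Proof. by elim: r => [|i r IH]; rewrite ?big_nil // !big_cons -IH. Qed.

Lemma op_sumE (I : Type) (r : seq I) (T : I -> H -> H) f :
  (\sum_(i <- r) T i) f = \sum_(i <- r) T i f.
Proof. by elim: r => [|i r IH]; rewrite ?big_nil // !big_cons -IH. Qed.

(** The square norm is a supremum of finite sums, and what is left after
    removing the terms of a nearly optimal one is small. *)
Lemma finite_support_dense f (e : R) : 0 < e ->
  exists r : seq G, l2norm (f - \sum_(h <- r) f h *: delta h) < e.
Proof.
move=> e0.
have sfin : sqnorm f \is a fin_num by rewrite sqnormE.
have e2 : 0 < e ^+ 2 by rewrite exprn_gt0.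
have [_ [A [finA _] <-] lt] := ub_ereal_sup_adherent e2 sfin.
pose r := finmap.enum_fset (fset_set A); exists r.
have memr x : (x \in r) = (x \in A) by rewrite -(in_fset_set finA).
have ur : uniq r by exact: finmap.fset_uniq.
have sumE x : (\sum_(h <- r) f h *: delta h) x = if x \in A then f x else 0.
  rewrite l2_sumE -memr.
  rewrite (eq_bigr (fun h => f h * (x == h)%:R)) //.
  case: ifPn => xr.
    rewrite (big_rem _ xr) /= eqxx mulr1 big_seq big1 ?addr0 // => h.
    by rewrite mem_rem_uniq // inE eq_sym => /andP[/negPf -> _]; rewrite mulr0.
  rewrite big_seq big1 // => h hr.
  have [xh|_] := eqVneq x h; last by rewrite mulr0.
  by rewrite xh hr in xr.
set d := f - _.
have dx x : d x = if x \in A then 0 else f x.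
  transitivity ((f x : C) - (\sum_(h <- r) f h *: delta h) x); first by [].
  by rewrite sumE; case: ifP; rewrite ?subrr ?subr0.
have dE : sqnorm d = (\esum_(x in ~` A) (normc (f x) ^+ 2)%:E)%E.
  rewrite [RHS]esum_mkcond; apply: eq_esum => x _; rewrite dx in_setC.
  by case: (x \in A); rewrite ?ComplexField.Normc.normc0 ?expr0n.
rewrite -ltr_sqr ?nnegrE ?l2norm_ge0 ?(ltW e0) // -lte_fin -sqnormE dE.
have n0 x : (0 <= (normc (f x) ^+ 2)%:E :> \bar R)%E by rewrite lee_fin sqr_ge0.
have fA : (\esum_(x in A) (normc (f x) ^+ 2)%:E)%E \is a fin_num.
  rewrite ge0_fin_numE ?esum_ge0 //; apply: le_lt_trans (_ : sqnorm f < +oo)%E.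
    by apply: le_esum_subset.
  by rewrite sqnormE ltry.
have split : (sqnorm f = \esum_(x in A) (normc (f x) ^+ 2)%:E +
    \esum_(x in ~` A) (normc (f x) ^+ 2)%:E)%E.
  by rewrite /sqnorm (esumID A) // !setTI.
have : (sqnorm f - (e ^+ 2)%:E < \esum_(x in A) (normc (f x) ^+ 2)%:E)%E.
  by rewrite esum_fset.
by rewrite split lteBlDr // addeC [ltRHS]addeC lteD2rE.
Qed.

(** The combinations of point masses are dense. *)
Lemma bounded_operator_eq0 T : bounded_operator T ->
  (forall h, T (delta h) = 0) -> T = 0.
Proof.
move=> [linT cT] T0; pose TL := GRing.isLinear.Build C H H _ T linT.
pose T' : {linear H -> H} := HB.pack T TL.
apply/funext => f; apply/eqP; rewrite -normr_eq0; apply/negPn/negP => Tf0.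
have Tf : 0 < `|T f| by rewrite lt_def Tf0 normr_ge0.
have Tf2 : 0 < `|T f| / 2 by rewrite divr_gt0.
have /cvgrPdist_le/(_ _ Tf2) := cT f.
move=> /nbhs_normP[d /= d0 Hd].
have [e e0 de] : exists2 e : R, 0 < e & d = e%:C.
  by case: d d0 {Hd} => x y; rewrite ltcE /= => /andP[/eqP -> x0]; exists x.
have [r Hr] := finite_support_dense f e0.
have := Hd (\sum_(h <- r) f h *: delta h).
rewrite /= de l2_normE ltcR => /(_ Hr).
have -> : T (\sum_(h <- r) f h *: delta h) = 0.
  rewrite -[T]/(T' : H -> H) linear_sum big1 // => h _.
  by rewrite linearZ /= T0 scaler0.
rewrite subr0 ler_pdivlMr // mulr_natr mulr2n gerDl.
by rewrite normr_le0 -normr_eq0 (negPf Tf0).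
Qed.

Lemma bounded_id : bounded_operator (id : H -> H).
Proof. by split=> [//|x]; exact: cvg_id. Qed.

Lemma bounded_left_regular g : bounded_operator (@left_regular R G g).
Proof.
split; first exact: left_regular_is_linear.
move=> f; apply/(@cvgrPdist_le _ _ _ (nbhs f)) => e e0.
apply/nbhs_normP; exists e => // z /= fz.
by rewrite -linearB norm_left_regular ltW.
Qed.

Local Notation A := (@reduced_group_Cstar_algebra R G).

Lemma regular_group_algebra_left_regular g :
  @regular_group_algebra R G (left_regular g).
Proof. by exists [:: (1, g)]; rewrite big_seq1 scale1r. Qed.

Lemma reduced_left_regular g : A (left_regular g).
Proof.
split; first exact: bounded_left_regular.
move=> e e0; exists (left_regular g).
  exact: regular_group_algebra_left_regular.
by rewrite subrr => f; rewrite normr0 mulr_ge0 // lecR ltW.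
Qed.

Lemma left_regular1_id : left_regular 1%g = id :> (H -> H).
Proof. by apply/funext => f; exact: left_regular1. Qed.

Definition powers_averaging := forall (ts : seq G) (e : R),
  (forall t, t \in ts -> t <> 1%g) -> 0 < e ->
  exists L, (0 < size L)%N /\
    forall t, t \in ts -> opnorm_le (twirl L (@left_regular R G t)) e.

Section Ideal.
Variable I : set (H -> H).
Hypothesis idealI : closed_ideal A I.

Lemma ideal0 : I 0. Proof. by case: idealI. Qed.

Lemma idealD S T : I S -> I T -> I (S + T).
Proof.
by case: idealI => _ _ lin _ _ IS IT; rewrite -[S]scale1r; exact: lin.
Qed.

Lemma idealZ (z : C) T : I T -> I (z *: T).
Proof.
case: idealI => _ I0 lin _ _ IT; rewrite -[z *: T]addr0; exact: lin.
Qed.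

Lemma ideal_left_regular g h T : I T ->
  I (left_regular g \o T \o left_regular h).
Proof.
case: idealI => _ _ _ mul _ IT.
have [_ ITh] := mul _ _ (reduced_left_regular h) IT.
by have [IgT _] := mul _ _ (reduced_left_regular g) ITh.
Qed.

Lemma ideal_twirl L T : I T -> I (twirl L T).
Proof.
move=> IT.
have -> : twirl L T = (size L)%:R^-1 *: \sum_(s <- L)
    (left_regular s \o T \o left_regular s^-1%g).
  apply/funext => f; rewrite twirlE.
  by rewrite [RHS]/((size L)%:R^-1 *: (\sum_(s <- L) _) f) op_sumE.
apply: idealZ; elim: L => [|s L IH]; first by rewrite big_nil; exact: ideal0.
by rewrite big_cons; apply: idealD => //; exact: ideal_left_regular.
Qed.

(** A nonzero matrix coefficient can be moved to the diagonal entry at the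
    identity by translating on both sides. *)
Lemma ideal_trace1 T : I T -> T <> 0 ->
  exists2 T', I T' & T' (delta 1%g) 1%g = 1.
Proof.
move=> IT nT; have [IA _ _ _ _] := idealI.
have [h Th] : exists h, T (delta h) <> 0.
  apply: contrapT => /forallNP T0; apply: nT.
  apply: bounded_operator_eq0; first by case: (IA _ IT).
  by move=> h; apply: contrapT; exact: T0.
have [k Tk] : exists k, T (delta h) k <> 0.
  apply: contrapT => /forallNP T0; apply: Th; apply: l2P => x.
  by apply: contrapT; exact: T0.
exists ((T (delta h) k)^-1 *: (left_regular k^-1%g \o T \o left_regular h)).
  by apply: idealZ; exact: ideal_left_regular.
transitivity ((T (delta h) k)^-1 *
    T (left_regular h (delta 1%g)) (k^-1^-1 * 1)%g).
  by [].
by rewrite left_regular_delta mulg1 invgK mulg1 mulVf //; exact/eqP.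
Qed.

(** Approximating an element of trace one by a finite combination of group
    elements and averaging its conjugates leaves only the identity. *)
Lemma ideal_id : powers_averaging -> I <> [set 0] -> I id.
Proof.
move=> powers nI.
have [T [IT nT]] : exists T, I T /\ T <> 0.
  apply: contrapT => /forallNP allz; apply: nI.
  apply/seteqP; split=> [T IT|_ ->]; last exact: ideal0.
  by apply: contrapT => nT; apply: (allz T).
have [a Ia a1] := ideal_trace1 IT nT.
have [IA _ _ _ closedI] := idealI.
apply: closedI; split; first exact: bounded_id.
move=> e e0; have [_ /(_ (e / 3)) []] := IA _ Ia; first by rewrite divr_gt0.
move=> _ [s ->]; set S := \sum_(p <- s) _ => aS.
pose c := \sum_(p <- s | p.2 == 1%g) p.1.
have S1 : S (delta 1%g) 1%g = c.
  rewrite /S op_sumE l2_sumE /c [RHS]big_mkcond; apply: eq_bigr => p _.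
  transitivity (p.1 * left_regular p.2 (delta 1%g) 1%g); first by [].
  rewrite left_regular_delta mulg1 /= /delta_fun eq_sym.
  by case: ifP; rewrite ?mulr1 ?mulr0.
have c1 : normc (1 - c) <= e / 3.
  rewrite -S1 -a1.
  apply: le_trans (norm_coef_le ((a - S) (delta 1%g)) 1%g) _.
  by have := aS (delta 1%g); rewrite !l2_normE norm_delta mulr1 lecR.
pose ts := [seq p.2 | p <- s & p.2 != 1%g].
pose M := \sum_(p <- s | p.2 != 1%g) normc p.1.
have M0 : 0 <= M by apply: sumr_ge0 => p _; exact: normc_ge0.
have [||L [L0 HL]] := powers ts (e / (3 * (M + 1))).
- by move=> t /mapP[p]; rewrite mem_filter => /andP[/eqP p1 _] ->.
- by rewrite divr_gt0 // mulr_gt0 // ltr_wpDl.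
exists (twirl L a); first exact: ideal_twirl.
pose rest := \sum_(p <- s | p.2 != 1%g) p.1 *: twirl L (left_regular p.2).
have tS : twirl L S = c *: id + rest.
  rewrite /S twirl_sum (bigID (fun p => p.2 == 1%g)) /=; congr (_ + _).
    rewrite scaler_suml; apply: eq_bigr => p /eqP ->.
    by rewrite twirlZ left_regular1_id twirl1.
  by apply: eq_bigr => p _; rewrite twirlZ.
have -> : id - twirl L a =
    (1 - c) *: id + (-1) *: twirl L (a - S) + (-1) *: rest.
  have -> : twirl L a = twirl L (a - S) + (c *: id + rest).
    by rewrite -tS -twirlD subrK.
  rewrite !scaleN1r scalerBl scale1r !opprD !addrA.
  by congr (_ - _); rewrite addrAC.
have op1 : opnorm_le (id : H -> H) 1 by move=> f; rewrite mul1r.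
have N1 : normc (-1 : C) = 1.
  by apply: complexI; rewrite -complex_normE normrN1.
have rest_le : opnorm_le rest
    (\sum_(p <- s | p.2 != 1%g) normc p.1 * (e / (3 * (M + 1)))).
  rewrite /rest -[\sum_(p <- s | _) _ *: _]big_filter.
  rewrite -[\sum_(p <- s | _) _ * _]big_filter.
  apply: (@opnorm_le_sum R G _ [seq p <- s | p.2 != 1%g]
    (fun p => p.1 *: twirl L (left_regular p.2))
    (fun p => normc p.1 * (e / (3 * (M + 1))))) => p ps.
  by apply: opnorm_leZ; apply: HL; apply/mapP; exists p.
have := opnorm_leD (opnorm_leD (opnorm_leZ (1 - c) op1)
  (opnorm_leZ (-1) (twirl_opnorm L0 aS))) (opnorm_leZ (-1) rest_le).
rewrite N1 !mul1r mulr1 -mulr_suml -/M => le_sum f.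
apply: (le_trans (le_sum f)); rewrite ler_wpM2r // lecR.
have M1 : M * (e / (3 * (M + 1))) <= e / 3.
  have -> : M * (e / (3 * (M + 1))) = e / 3 * (M / (M + 1)).
    by field; rewrite gt_eqF // ltr_wpDl.
  rewrite ler_piMr ?divr_ge0 ?(ltW e0) // ler_pdivrMr ?ltr_wpDl // mul1r.
  by rewrite lerDl.
by lra.
Qed.

End Ideal.

Theorem simple_of_powers_averaging : powers_averaging -> Cstar_simple R G.
Proof.
move=> powers; split.
  exists id; first by rewrite -left_regular1_id; exact: reduced_left_regular.
  move=> /(congr1 (fun T : H -> H => T (delta 1%g) 1%g)) /= /eqP.
  by rewrite /delta_fun eqxx oner_eq0.
move=> I idealI; have [->|nI] := pselect (I = [set 0]); [by left|right].
have Iid := ideal_id idealI powers nI.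
have [IA _ _ mul _] := idealI.
by apply/seteqP; split=> // S AS; have [] := mul _ _ AS Iid.
Qed.

End PowersAveraging.

(** * Comparison along the fibres of an equivariant map *)

Section FibredEsum.
Variables (R : realType) (Y : choiceType).

(** Minkowski's inequality with bounds in place of norms, as the sums may be
    infinite a priori. *)
Lemma minkowski2 (E : set Y) (u v : Y -> R) (p q : R) : 0 <= p -> 0 <= q ->
  (\esum_(x in E) (u x ^+ 2)%:E <= (p ^+ 2)%:E)%E ->
  (\esum_(x in E) (v x ^+ 2)%:E <= (q ^+ 2)%:E)%E ->
  (\esum_(x in E) ((u x + v x) ^+ 2)%:E <= ((p + q) ^+ 2)%:E)%E.
Proof.
have vanish (w : Y -> R) : (\esum_(x in E) (w x ^+ 2)%:E <= (0 ^+ 2)%:E)%E ->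
    forall x, E x -> w x = 0.
  move=> w0 x Ex; apply/eqP; rewrite -sqrf_eq0 eq_le sqr_ge0 andbT -lee_fin.
  rewrite expr0n in w0; apply: le_trans w0; apply: esum_ge.
  by exists [set x]; [split => // _ ->|rewrite fsbig_set1].
move=> p0 q0 up vq.
have [p00|pn0] := eqVneq p 0.
  rewrite p00 add0r; apply: le_trans vq; apply: le_esum => x Ex.
  by rewrite (vanish u) ?add0r // -p00.
have [q00|qn0] := eqVneq q 0.
  rewrite q00 addr0; apply: le_trans up; apply: le_esum => x Ex.
  by rewrite (vanish v) ?addr0 // -q00.
have pp : 0 < p by rewrite lt_def pn0.
have qp : 0 < q by rewrite lt_def qn0.
(* with the weights 1 + q / p and 1 + p / q the bounds p and q add up *)
have k1 : 0 <= 1 + q / p by rewrite addr_ge0 // divr_ge0.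
have k2 : 0 <= 1 + p / q by rewrite addr_ge0 // divr_ge0.
have -> : (p + q) ^+ 2 = (1 + q / p) * p ^+ 2 + (1 + p / q) * q ^+ 2.
  by field; rewrite pn0 qn0.
rewrite EFinD !EFinM.
have k1e : (0 <= (1 + q / p)%:E)%E by rewrite lee_fin.
have k2e : (0 <= (1 + p / q)%:E)%E by rewrite lee_fin.
apply: le_trans (leeD (lee_wpmul2l k1e up) (lee_wpmul2l k2e vq)).
have u2 x : 0 <= u x ^+ 2 by exact: sqr_ge0.
have v2 x : 0 <= v x ^+ 2 by exact: sqr_ge0.
rewrite -!esumZ // -esumD; last 2 first.
- by move=> x _; rewrite lee_fin mulr_ge0.
- by move=> x _; rewrite lee_fin mulr_ge0.
apply: le_esum => x _; rewrite -EFinD lee_fin -subr_ge0.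
have -> : (1 + q / p) * u x ^+ 2 + (1 + p / q) * v x ^+ 2 - (u x + v x) ^+ 2 =
    (q * u x - p * v x) ^+ 2 / (p * q) by field; rewrite pn0 qn0.
by rewrite divr_ge0 ?sqr_ge0 // mulr_ge0.
Qed.

Lemma minkowski_sum (I : eqType) (r : seq I) (E : set Y)
    (u : I -> Y -> R) (p : I -> R) :
  (forall i, 0 <= p i) ->
  (forall i, i \in r ->
     (\esum_(x in E) (u i x ^+ 2)%:E <= (p i ^+ 2)%:E)%E) ->
  (\esum_(x in E) ((\sum_(i <- r) u i x) ^+ 2)%:E <=
    ((\sum_(i <- r) p i) ^+ 2)%:E)%E.
Proof.
move=> p0; elim: r => [|i r IH] up.
  rewrite esum1 => [|x _]; first by rewrite big_nil expr0n.
  by rewrite big_nil expr0n.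
rewrite big_cons; under eq_esum do rewrite big_cons.
apply: minkowski2 => //; first exact: sumr_ge0.
  by apply: up; rewrite mem_head.
by apply: IH => j jr; apply: up; rewrite in_cons jr orbT.
Qed.

Lemma esum_fibres (T : choiceType) (D : set T) (rho : Y -> T)
    (f : Y -> \bar R) :
  (forall x, D (rho x)) -> (forall x, (0 <= f x)%E) ->
  (\esum_(x in [set: Y]) f x =
   \esum_(y in D) \esum_(x in rho @^-1` [set y]) f x)%E.
Proof.
move=> Drho f0; rewrite esum_esum //.
rewrite [RHS](reindex_esum [set: Y] _ (fun x => (rho x, x))) //; split.
- by move=> x _; split => /=.
- by move=> x x' _ _ [].
- by move=> [y x] [/= Dy e]; exists x => //=; rewrite -e.
Qed.

End FibredEsum.

Section TwirlBound.
Variables (R : realType) (G : groupType) (T : choiceType) (a : G -> T -> T).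
Variables (K : set G) (D : set T) (rho : G -> T) (t : G).
Hypotheses (KV : forall g, K g -> K g^-1%g)
  (Drho : forall x, D (rho x))
  (rho_equiv : forall k x, K k -> rho (k * x)%g = a k (rho x))
  (rho_inv : forall k x, K k -> rho (t * k * t^-1 * x)%g = rho x).
Local Notation normc := ComplexField.Normc.normc.

(** Summing squares along the fibres of a map that is equivariant for [K] and
    invariant for its conjugate by [t] turns the conjugates of the translation
    by [t] into the action of [K] on the base. *)
Lemma twirl_le_average (L : seq G) (e : R) : 0 <= e ->
  (forall s, s \in L -> K s) ->
  (forall F, (sqsum D F < +oo)%E ->
    (sqsum D (average a L F) <= (e ^+ 2)%:E * sqsum D F)%E) ->
  opnorm_le (twirl L (@left_regular R G t)) e.
Proof.
move=> e0 LK HL f.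
pose n : R := (size L)%:R.
pose w x := normc (f (t^-1 * x)%g).
have w0 x : 0 <= w x by exact: normc_ge0.
pose b s x : G := (t * s * t^-1 * (s^-1 * x))%g.
have sumw : (\esum_(x in [set: G]) (w x ^+ 2)%:E = sqnorm f)%E.
  rewrite /sqnorm [RHS](reindex_esum [set: G] [set: G] (fun x => (t^-1 * x)%g)) //.
  split=> //; first by move=> x y _ _ /mulgI.
  by move=> x _; exists (t * x)%g; rewrite // mulKg.
pose F y := Num.sqrt (fine (\esum_(x in rho @^-1` [set y]) (w x ^+ 2)%:E)%E).
have FE y : ((F y ^+ 2)%:E = \esum_(x in rho @^-1` [set y]) (w x ^+ 2)%:E)%E.
  have ge0 : (0 <= \esum_(x in rho @^-1` [set y]) (w x ^+ 2)%:E)%E.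
    by apply: esum_ge0 => x _; rewrite lee_fin sqr_ge0.
  rewrite /F sqr_sqrtr ?fine_ge0 // fineK // ge0_fin_numE //.
  apply: le_lt_trans (_ : sqnorm f < +oo)%E; last by rewrite sqnormE ltry.
  by rewrite -sumw; apply: le_esum_subset.
have F0 y : 0 <= F y by exact: sqrtr_ge0.
have NF : sqsum D F = sqnorm f.
  rewrite -sumw (esum_fibres (rho := rho) Drho) //; last first.
    by move=> x; rewrite lee_fin sqr_ge0.
  by apply: eq_esum => y _; rewrite FE.
set g := twirl _ _ f.
have gE x : normc (g x) <= n^-1 * \sum_(s <- L) w (b s x).
  rewrite -lecR -complex_normE.
  have -> : g x = (size L)%:R^-1 * \sum_(s <- L) f (t^-1 * b s x)%g.
    rewrite /g twirlE; transitivity ((size L)%:R^-1 * (\sum_(s <- L)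
      left_regular s (left_regular t (left_regular s^-1%g f))) x); first by [].
    rewrite l2_sumE; congr (_ * _); apply: eq_bigr => s _ /=.
    by rewrite /b invgK !mulgA mulVg mul1g.
  rewrite normrM normfV normr_nat rmorphM fmorphV rmorph_nat.
  rewrite ler_wpM2l ?invr_ge0 ?ler0n //.
  apply: le_trans (ler_norm_sum _ _ _) _; rewrite rmorph_sum.
  by apply: ler_sum => s _; rewrite complex_normE.
have rho_b s x : K s -> rho (b s x) = a s^-1%g (rho x).
  by move=> Ks; rewrite /b rho_inv // rho_equiv //; exact: KV.
have b_inj s : injective (b s) by move=> x y /mulgI /mulgI.
have n0 : 0 <= n^-1 by rewrite invr_ge0 ler0n.
have fib y : (\esum_(x in rho @^-1` [set y])
      ((n^-1 * \sum_(s <- L) w (b s x)) ^+ 2)%:E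
    <= (average a L F y ^+ 2)%:E)%E.
  under eq_esum do rewrite exprMn.
  rewrite esumZ ?sqr_ge0 //; last by move=> x; exact: sqr_ge0.
  rewrite /average exprMn -/n [leRHS]EFinM.
  apply: lee_wpmul2l; first by rewrite lee_fin sqr_ge0.
  apply: (minkowski_sum (u := fun s x => w (b s x))
    (p := fun s => F (a s^-1%g y))) => //.
  move=> s /LK Ks; rewrite FE.
  rewrite -(esum_image _ (b s) (fun x => (w x ^+ 2)%:E)); last first.
    by move=> x x' _ _; exact: b_inj.
  apply: le_esum_subset => _ [x /= <- <-]; exact: rho_b.
have : (sqnorm g <= (e ^+ 2)%:E * sqnorm f)%E.
  have Ff : (sqsum D F < +oo)%E by rewrite NF sqnormE ltry.
  rewrite -NF; apply: le_trans (HL F Ff).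
  apply: (@le_trans _ _ (\esum_(x in [set: G])
      ((n^-1 * \sum_(s <- L) w (b s x)) ^+ 2)%:E)%E).
    apply: le_esum => x _; rewrite lee_fin ler_sqr ?nnegrE ?normc_ge0 //.
    by rewrite mulr_ge0 // sumr_ge0.
  rewrite (esum_fibres (rho := rho) Drho); last first.
    by move=> x; rewrite lee_fin sqr_ge0.
  by apply: le_esum => y _; exact: fib.
rewrite !sqnormE -EFinM lee_fin -exprMn ler_sqr ?nnegrE ?mulr_ge0 ?l2norm_ge0 //.
by rewrite !l2_normE -rmorphM lecR.
Qed.

End TwirlBound.

(** * Averaging in the full group *)

Section FullGroupAveraging.
Variables (R : realType) (Gamma : groupType) (X : compactHausdorffType).
Variable phi : top_action Gamma X.
Hypotheses (zdX : zero_dimensional X) (perfectX : forall x : X, ~ open [set x]).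
Hypotheses (phi_minimal : minimal phi) (phi_free : topologically_free phi).
Hypothesis nonamenable : ~ amenable R Gamma.
Local Notation FG := (full_group phi).
Local Notation K := (rigid_stabilizer phi).
Implicit Types (h k t : FG) (x y z : X) (U V O : set X).

Let hX : hausdorff_space X := hausdorff_setT.
Let cX : compact [set: X] := compact_setT.

(** A choice that depends on [h] only through the preimage of [U], hence does
    not change when [h] is multiplied on the left by an element preserving
    [U]. *)
Definition landing_point U x0 h : X := xget x0 [set y | U (homeo h y)].

Definition landing_arrow U x0 h : transformation_groupoid phi :=
  (cocycle h (landing_point U x0 h), landing_point U x0 h).

Lemma landing_arrow_into U x0 h : U x0 ->
  arrows_into phi U (landing_arrow U x0 h).
Proof.
move=> Ux0; have : U (homeo h (homeo h^-1%g x0)) by rewrite homeoVK.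
by move=> Uh; exact: (xgetPex x0 (ex_intro (fun y => U (homeo h y)) _ Uh)).
Qed.

Lemma landing_arrowM U x0 h k : U x0 ->
  (forall y, U (homeo k y) <-> U y) ->
  landing_arrow U x0 (k * h)%g = gact phi k (landing_arrow U x0 h).
Proof.
move=> Ux0 kU.
have e : landing_point U x0 (k * h)%g = landing_point U x0 h.
  congr xget; apply/seteqP; split=> y /=; rewrite homeoM => /kU //.
by rewrite /landing_arrow e /gact /= cocycleM.
Qed.

(** The conjugate is supported in the image of [U] under [t], away from [U]. *)
Lemma rigid_displaced U k t : (forall x, U x -> ~ U (homeo t x)) ->
  K U k -> K (~` U) (t * k * t^-1)%g.
Proof.
move=> tU Kk x /contrapT Ux.
have Utx : ~ U (homeo t^-1%g x).
  by move=> /tU; rewrite homeoVK.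
rewrite -mulgA cocycleM homeoM (rigid_homeo Kk Utx) cocycleM (Kk _ Utx).
by rewrite mul1g -cocycleM mulgV cocycle1.
Qed.

(** There is no invariant mean on the arrows into [U], so averages over the rigid
    stabilizer are small there, and [landing_arrow] carries this over to the
    regular representation. *)
Lemma twirl_rigid U t (e : R) : clopen U -> U !=set0 ->
  (forall x, U x -> ~ U (homeo t x)) -> 0 < e ->
  exists L, [/\ forall s, s \in L -> K U s, (0 < size L)%N &
    opnorm_le (twirl L (@left_regular R FG t)) e].
Proof.
move=> cU [x0 Ux0] tU e0.
have nomean : ~ (exists m : set (transformation_groupoid phi) -> R,
    mean_on (gact phi) (K U) (arrows_into phi U) m).
  move=> [m mm]; apply: nonamenable.
  by apply: (amenable_of_mean zdX perfectX phi_minimal cU mm); exists x0.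
have e2 : 0 < e ^+ 2 by rewrite exprn_gt0.
have [||||||L [LK L0 HL]] := @average_small _ _ _ (gact phi) _ _ (K U)
  (arrows_into phi U) _ _ _ _ nomean _ e2.
- exact: gact1.
- exact: gactM.
- exact: rigid1.
- by move=> g h; exact: rigidM.
- by move=> g; exact: rigidV.
- by move=> g u; exact: gact_arrows.
exists L; split=> //.
apply: (@twirl_le_average _ _ _ (gact phi) (K U) (arrows_into phi U)
  (landing_arrow U x0)) => //.
- by move=> g; exact: rigidV.
- by move=> h; exact: landing_arrow_into.
- by move=> k h Kk; apply: landing_arrowM => // y; exact: rigid_stable.
- move=> k h Kk; have Kt := rigid_displaced tU Kk.
  rewrite landing_arrowM // => [|y]; last first.
    have H := rigid_stable y Kt; split=> Uy; apply: contrapT => n.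
      by have : (~` U) (homeo (t * k * t^-1)%g y) by apply/H.
    by have /H : (~` U) (homeo (t * k * t^-1)%g y).
  rewrite /gact Kt; first by rewrite mul1g; case: (landing_arrow _ _ _).
  by apply; exact: landing_arrow_into.
- exact: ltW.
Qed.

Lemma open_avoid (zs : seq X) O : open O -> O !=set0 ->
  exists x, O x /\ x \notin zs.
Proof.
elim: zs O => [|z zs IH] O oO O0; first by have [x Ox] := O0; exists x.
have [||x [[Ox xz] xzs]] := IH (O `\ z).
- rewrite setDE; apply: openI => //; apply: closed_openC.
  by apply: accessible_closed_set1; exact: hausdorff_accessible.
- apply: contrapT => /forallNP nO; apply: (@perfectX z).
  suff <- : O = [set z] by [].
  have OZ y : O y -> y = z by move=> Oy; apply: contrapT => yz; apply: (nO y).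
  apply/seteqP; split=> [y /OZ //|_ ->].
  by have [y Oy] := O0; rewrite -(OZ _ Oy).
by exists x; split=> //; rewrite in_cons negb_or xzs andbT; apply/eqP.
Qed.

Lemma open_notin (zs : seq X) : open [set x | x \notin zs].
Proof.
elim: zs => [|z zs IH].
  rewrite (_ : [set x | _] = setT); first exact: openT.
  by apply/seteqP; split.
rewrite (_ : [set x | _] = ~` [set z] `&` [set x | x \notin zs]).
  apply: openI => //; apply: closed_openC.
  by apply: accessible_closed_set1; exact: hausdorff_accessible.
apply/seteqP; split=> x /=; rewrite in_cons negb_or.
  by move=> /andP[/eqP].
by move=> [/eqP -> ->].
Qed.

(** One displaced set per element, all disjoint: the stabilizers commute, so the
    average that makes one translation small can be taken first, and the others
    do not increase the norm. The points [zs] reserve room for the sets of the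
    elements treated later. *)
Lemma twirl_all (ts : seq FG) (e : R) (zs : seq X) :
  (forall t, t \in ts -> t <> 1%g) -> 0 < e ->
  exists O (L : seq FG), [/\ clopen O, forall z, z \in zs -> ~ O z,
    forall s, s \in L -> K O s, (0 < size L)%N &
    forall t, t \in ts -> opnorm_le (twirl L (@left_regular R FG t)) e].
Proof.
elim: ts zs => [|t ts IH] zs nt e0.
  exists set0, [:: 1%g]; split=> //.
  - by split; [exact: open0|exact: closed0].
  - by move=> z _.
  by move=> s; rewrite inE => /eqP ->; exact: rigid1.
have [x1 tx1] : exists x, homeo t x <> x.
  by apply: moved_point => //; apply: nt; rewrite mem_head.
have [W [cW Wx1 _ tW]] := displaced_clopen hX zdX cX
  (@continuous_homeo _ _ _ t x1) (@filterT _ (nbhs x1) _) tx1.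
have [||x [Wx xzs]] := @open_avoid zs W; [by case: cW|by exists x1|].
have [|//|O [L [cO Ozs LK L0 HL]]] := IH (x :: zs).
  by move=> s sts; apply: nt; rewrite in_cons sts orbT.
have nx : nbhs x (W `&` (~` O `&` [set y | y \notin zs])).
  apply: open_nbhs_nbhs; split.
    apply: openI; first by case: cW.
    apply: openI; last exact: open_notin.
    by apply: closed_openC; case: cO.
  by split=> //; split=> //; apply: Ozs; rewrite mem_head.
have [U [cU Ux UW]] := clopen_nbhs_basis hX zdX cX nx.
have tU y : U y -> ~ U (homeo t y).
  by move=> /UW[/tW nW _] /UW[].
have OU : O `&` U = set0.
  by apply/seteqP; split=> // y [Oy /UW[_ [nO _]]]; exact: nO.
have [|L' [L'K L'0 HL']] := twirl_rigid cU _ tU e0; first by exists x.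
exists (O `|` U), [seq (s * r)%g | s <- L, r <- L']; split.
- exact: clopenU.
- move=> z zzs [Oz|/UW[_ [_ /=]]]; last by rewrite zzs.
  by apply: Ozs Oz; rewrite in_cons zzs orbT.
- move=> _ /allpairsP[[s r] /= [/LK Ks /L'K Kr ->]]; apply: rigidM.
    by apply: sub_rigid Ks => y; left.
  by apply: sub_rigid Kr => y; right.
- by rewrite size_allpairs muln_gt0 L0.
move=> s; rewrite in_cons twirlM => /orP[/eqP ->|sts].
  exact: twirl_opnorm.
rewrite twirlC; first by apply: twirl_opnorm => //; exact: HL.
by move=> u r /LK Ku /L'K Kr; exact: rigid_commute OU Ku Kr.
Qed.

Theorem full_group_Cstar_simple : Cstar_simple R FG.
Proof.
apply: simple_of_powers_averaging => ts e nt e0.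
have [W [L [_ _ _ L0 HL]]] := twirl_all [::] nt e0.
by exists L.
Qed.

End FullGroupAveraging.

Theorem corollary5p4 (R : realType) (Gamma : groupType)
    (phi : top_action Gamma cantor_space)
    (countable_Gamma : countable [set: Gamma])
    (nonamenable_Gamma : ~ amenable R Gamma)
    (free_phi : topologically_free phi)
    (minimal_phi : minimal phi) :
  Cstar_simple R (full_group phi).
Proof.
apply: full_group_Cstar_simple => //; first exact: cantor_zero_dimensional.
exact/perfectTP/cantor_perfect.
Qed.
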